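(* Let $n\ge 1$ and let $Y\cup T\in\mathcal{LR}^{(n)}$ with $Y=Y_\mu$ and $T$ a ballot tableau of shape $\lambda/\mu$ and weight $\nu$. Let $V_n$ be the subword of the $n$th row of $T$ consisting of its entries in $[n-1]$, and let $\nu_n$ be the number of entries of $T$ equal to $n$. Then $$\rho_1^{(n)}(Y\cup T)=\chi_n^{\mu_n}\,\bar\phi_{V_n}\,\bar\phi_n^{\nu_n}\,\rho_1^{(n-1)}\big[(Y\cup T)^{(n-1)}\big].$$ In particular, all $|V_n|$ bumping routes of the $\bar\phi_{V_n}$-insertions are pairwise disjoint and terminate in the $n$th row.
   Context: Partitions are identified with Young diagrams (English convention, cell $(i,j)$ in row $i$, column $j$); $[n]=\{1,\dots,n\}$. A semistandard skew tableau of shape $\lambda/\mu$ fills $\lambda\setminus\mu$ with positive integers weakly increasing along rows and strictly increasing down columns. Its reading word is read left to right along rows, from the bottom row to the top. A word is ballot (Yamanouchi) if every suffix contains at least as many $i$'s as $(i+1)$'s for every $i$; a tableau is ballot if its reading word is. $Y_\mu$ denotes the Yamanouchi tableau of shape $\mu$ (row $i$ filled with $i$'s). If $U$ has shape $\lambda/\mu$ and $V$ has shape $\gamma/\lambda$, $U\cup V$ denotes the pair glued along $\lambda$. $\mathcal{LR}^{(n)}$ is the set of pairs $Y_\mu\cup T$ with $T$ ballot of shape $\lambda/\mu$, $\ell(\lambda)\le n$. For such a pair and $0\le i\le n$, $(Y\cup T)^{(i)}$ denotes the pair restricted to its first $i$ rows (an element of $\mathcal{LR}^{(i)}$). Switching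 (Benkart–Sottile–Stroomer): on a pair $U\cup V$, a switch interchanges a letter $u$ of $U$ with a horizontally or vertically adjacent letter $v$ of $V$ lying after it, provided that afterwards both the cells of $U$ and the cells of $V$ still satisfy the semistandard conditions (rows weakly increasing, columns strictly increasing). Performing switches until none is possible yields a pair $S\cup H$ of the same total shape ($S$ inner, $H$ outer), independent of the choices; $\rho_1(U\cup V):=S\cup H$. $\rho_1^{(n)}$ is $\rho_1$ restricted to $\mathcal{LR}^{(n)}$ (it maps $\mathcal{LR}^{(n)}$ to itself), and $\rho_1^{(0)}(\emptyset)=\emptyset$. Internal row insertion: for a tableau $H$ of shape $\gamma/\alpha$, an inner corner is a cell $(i,j)\in\gamma/\alpha$ with $(i-1,j),(i,j-1)\notin\gamma/\alpha$, or an empty cell $(i,\alpha_i+1)$ with $(i-1,\alpha_i+1),(i,\alpha_i)\notin\gamma/\alpha$. When $(i,\alpha_i+1)$ is an inner corner, $\phi_i H$ removes the entry of that cell (the cell joins the inner shape), Schensted row-inserts it into row $i+1$, the bumped entry into row $i+2$, and so on until an entry settles at the end of a row (the sequence of cells involved is the bumping route); if the cell is empty, $\phi_i$ just adjoins it to the inner shape. On pairs, $\bar\phi_i(Y_\alpha\cup H):=Y_{\alpha+e_i}\cup\phi_i(H)$, where $\alpha+e_i$ adds one to the $i$th part (for $i=\ell(\alpha)+1$ this appends a part $1$). For a word $w=w_m\cdots w_1$, $\bar\phi_w:=\bar\phi_{w_m}\circ\cdots\circ\bar\phi_{w_1}$ (so $w_1$ acts first). The operator $\chi_n$ appends one entry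 $n$ at the end of the $n$th row of the outer tableau $H$ of a pair $Y_\alpha\cup H$; $\chi_n^{\mu_n}$ is its $\mu_n$-fold iterate. *)

(* Defs.v *)
From mathcomp Require Import all_boot.
From Stdlib Require Import Relation_Operators.

Set Implicit Arguments.
Unset Strict Implicit.
Unset Printing Implicit Defensive.

(* Rows and columns of cells are numbered from 0, whereas letters and the     *)
(* index i of the operators phi_i and chi_i are numbered from 1, so that the  *)
(* i-th row of the text is the row of index i.-1.                             *)

Definition is_part (s : seq nat) : bool := sorted geq s && (0 \notin s).

(* (alpha, H) stands for the pair Y_alpha \cup H: row r of H is the sequence  *)
(* nth [::] H r, and its first entry lies in column nth 0 alpha r.            *)
Definition ypair : Type := (seq nat * seq (seq nat))%type.

(* A filling of a straight shape by letters coming from two tableaux U and V: *)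
(* (true, x) is a letter x of U, and (false, x) is a letter x of V.           *)
Definition filling : Type := seq (seq (bool * nat)).

(* Y_alpha \cup H as a filling, the letters of Y_alpha having origin b and    *)
(* those of H the other origin.                                               *)
Definition glue (b : bool) (P : ypair) : filling :=
  mkseq (fun r => nseq (nth 0 P.1 r) (b, r.+1)
                  ++ [seq (~~ b, x) | x <- nth [::] P.2 r])
        (size P.2).

Definition cell_of (F : filling) (r c : nat) : option (bool * nat) :=
  onth (nth [::] F r) c.

Definition has_letter (b : bool) (F : filling) (r c x : nat) : Prop :=
  cell_of F r c = Some (b, x).

(* The letters of one origin need not occupy consecutive cells, hence         *)
(* arbitrary pairs of cells of a row or of a column are compared.             *)
Definition semistandard (b : bool) (F : filling) : Prop :=
  (forall r c c' x y, c < c' ->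
     has_letter b F r c x -> has_letter b F r c' y -> x <= y) /\
  (forall r r' c x y, r < r' ->
     has_letter b F r c x -> has_letter b F r' c y -> x < y).

(* H is a semistandard tableau with positive entries, of shape gamma / alpha  *)
(* with gamma the shape of the glued filling. The list H has exactly one row  *)
(* for each part of gamma.                                                    *)
Definition skew_pair (P : ypair) : Prop :=
  [/\ is_part P.1, size P.1 <= size P.2, is_part (shape (glue true P)),
      0 \notin flatten P.2 & semistandard false (glue true P)].

Definition reading_word (H : seq (seq nat)) : seq nat := flatten (rev H).

Definition ballot (w : seq nat) : Prop :=
  forall k i, 0 < i -> count_mem i.+1 (drop k w) <= count_mem i (drop k w).

Definition LR (n : nat) (P : ypair) : Prop :=
  [/\ skew_pair P, size P.2 <= n & ballot (reading_word P.2)].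

Definition restrict (k : nat) (P : ypair) : ypair := (take k P.1, take k P.2).

Definition set_cell (F : filling) (r c : nat) (e : bool * nat) : filling :=
  set_nth [::] F r (set_nth e (nth [::] F r) c e).

Definition switch (F G : filling) : Prop :=
  exists r c r' c' u v,
    [/\ (r', c') = (r, c.+1) \/ (r', c') = (r.+1, c),
        has_letter true F r c u /\ has_letter false F r' c' v,
        G = set_cell (set_cell F r c (false, v)) r' c' (true, u)
      & semistandard true G /\ semistandard false G].

Definition switch_final (F G : filling) : Prop :=
  clos_refl_trans filling switch F G /\ ~ (exists G', switch G G').

(* rho1 P Q says that the maximal sequences of switches starting from the     *)
(* pair P (with U = Y_mu and V = T) all end at Q = S \cup H, and that there   *)
(* is at least one. In the end S consists of the letters of V and H of those  *)
(* of U, whence the change of origin. The form (alpha, H) of Q includes that  *)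
(* S is the Yamanouchi tableau Y_alpha.                                       *)
Definition rho1 (P Q : ypair) : Prop :=
  skew_pair Q /\
  (forall G : filling, switch_final (glue true P) G <-> G = glue false Q).

Definition in_skew (P : ypair) (r c : nat) : bool :=
  nth 0 P.1 r <= c < nth 0 P.1 r + size (nth [::] P.2 r).

(* Schensted insertion of x in rows, the list of the rows of index r, r+1, .. *)
(* of a tableau with inner shape alpha; the second component is the sequence  *)
(* of the cells where a letter is placed.                                     *)
Fixpoint row_insert (alpha : seq nat) (x r : nat) (rows : seq (seq nat)) :
    seq (seq nat) * seq (nat * nat) :=
  if rows is row :: rows' then
    let k := find (fun y => x < y) row in
    let cell := (r, nth 0 alpha r + k) in
    if k < size row then
      let rec := row_insert alpha (nth 0 row k) r.+1 rows' in
      (set_nth 0 row k x :: rec.1, cell :: rec.2)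
    else (rcons row x :: rows', [:: cell])
  else ([:: [:: x]], [:: (r, nth 0 alpha r)]).

(* The cell (r, alpha_r), empty or not, is an inner corner of gamma / alpha.  *)
(* For an empty cell, the last condition is needed for Y_{alpha + e} to make  *)
(* sense; for a nonempty one it follows from the first.                       *)
Definition inner_corner (P : ypair) (r : nat) : bool :=
  let c := nth 0 P.1 r in
  [&& (r == 0) || ~~ in_skew P r.-1 c,
      (c == 0) || ~~ in_skew P r c.-1
    & is_part (incr_nth P.1 r)].

(* \bar\phi_i together with its bumping route; None when it is not defined.   *)
Definition phi_route (i : nat) (P : ypair) :
    option (ypair * seq (nat * nat)) :=
  let r := i.-1 in
  let c := nth 0 P.1 r in
  if (0 < i) && inner_corner P r then
    if nth [::] P.2 r is x :: row then
      let ins := row_insert P.1 x r.+1 (drop r.+1 P.2) in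
      Some (incr_nth P.1 r, take r P.2 ++ row :: ins.1, (r, c) :: ins.2)
    else Some (incr_nth P.1 r, set_nth [::] P.2 r [::], [:: (r, c)])
  else None.

Definition phi (i : nat) (P : ypair) : option ypair :=
  omap fst (phi_route i P).

(* The rightmost letter of w acts first. *)
Definition phi_word (w : seq nat) (P : ypair) : option ypair :=
  foldr (fun i => obind (phi i)) (Some P) w.

(* The bumping routes of the successive insertions in phi_word w P. *)
Fixpoint phi_word_routes (w : seq nat) (P : ypair) : seq (seq (nat * nat)) :=
  if w is i :: w' then
    if obind (phi_route i) (phi_word w' P) is Some (_, route)
    then route :: phi_word_routes w' P
    else phi_word_routes w' P
  else [::].

Definition chi (n : nat) (P : ypair) : ypair :=
  (P.1, set_nth [::] P.2 n.-1 (rcons (nth [::] P.2 n.-1) n)).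

Definition disjoint_routes (s t : seq (nat * nat)) : bool :=
  ~~ has (fun c => c \in s) t.

(* Main.v *)
Require Import Defs.
From mathcomp Require Import all_boot all_order.
From mathcomp Require Import zify.
From Stdlib Require Import Relation_Operators Operators_Properties.

Import Order.TTheory.

Set Implicit Arguments.
Unset Strict Implicit.
Unset Printing Implicit Defensive.

(** Two switches that are possible at the same time commute, so all maximal
    sequences of switches end at the same filling and it suffices to follow a
    convenient one. Letting the letters of V pass one value after the other
    through the values of U, one exchanges two adjacent horizontal strips each
    time, and the shapes that occur form a grid governed by a min-max local rule
    [toggle]; the resulting H is read off the last line of the grid.

    For the recursion, the letters n of U just slide to the end of row n, which
    accounts for chi_n. Prepending a letter x to the last row of T adds one cell
    to the shapes of the right boundary of the grid from line x on, and the
    local rule propagates this to one added cell in every shape of these lines.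
    The row of the added cell moves along the last line exactly as prescribed
    by Schensted bumping, from row x down to row n: this is phi_x. Successive
    added cells stay weakly above each other at every value, whence disjoint
    routes. *)

(** * Confluence of switching *)

Lemma cell_of_lt F r c e : cell_of F r c = Some e ->
  r < size F /\ c < size (nth [::] F r).
Proof.
rewrite /cell_of => Fe.
have lt_c : c < size (nth [::] F r) by rewrite -onthTE Fe.
split=> //; rewrite ltnNge; apply: contraL lt_c => le_r.
by rewrite (nth_default _ le_r).
Qed.

Lemma filling_ext (F G : filling) : size F = size G ->
  (forall r c, cell_of F r c = cell_of G r c) -> F = G.
Proof.
move=> size_FG eq_FG; apply: (@eq_from_nth _ [::]) => // r _.
exact: eq_from_onth (eq_FG r).
Qed.

Lemma size_set_cell F r c e d : cell_of F r c = Some d ->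
  size (set_cell F r c e) = size F.
Proof.
by move=> /cell_of_lt[lt_r _]; rewrite size_set_nth; apply/maxn_idPr.
Qed.

Lemma cell_of_set_cell F r c e r' c' d : cell_of F r c = Some d ->
  cell_of (set_cell F r c e) r' c' =
  if (r', c') == (r, c) then Some e else cell_of F r' c'.
Proof.
move=> /cell_of_lt[lt_r lt_c].
rewrite /cell_of /set_cell nth_set_nth /= xpair_eqE.
case: eqP => [->|] //=.
have size_row : size (set_nth e (nth [::] F r) c e) = size (nth [::] F r).
  by rewrite size_set_nth; apply/maxn_idPr.
have [lt_c'|ge_c'] := ltnP c' (size (nth [::] F r)); last first.
  by rewrite !onth_default ?size_row // ifN //; apply/eqP; lia.
by rewrite !onthE !(nth_map e) ?size_row // nth_set_nth /=; case: eqP.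
Qed.

Definition adjacent (p q : nat * nat) : Prop :=
  q = (p.1, p.2.+1) \/ q = (p.1.+1, p.2).

Definition letter_at b F (p : nat * nat) x := has_letter b F p.1 p.2 x.

Definition ordered (p : nat * nat) x (q : nat * nat) y : Prop :=
  (p.1 = q.1 -> p.2 < q.2 -> x <= y) /\ (p.2 = q.2 -> p.1 < q.1 -> x < y).

Lemma semistandardP b F : semistandard b F <->
  forall p x q y, letter_at b F p x -> letter_at b F q y -> ordered p x q y.
Proof.
split=> [[ss_row ss_col] [r c] x [r' c'] y /= Fx Fy | ss].
  split=> /= [eq_r lt_c|eq_c lt_r].
    by apply: ss_row lt_c Fx _; rewrite eq_r.
  by apply: ss_col lt_r Fx _; rewrite eq_c.
split=> [r c c' x y lt_c Fx Fy|r r' c x y lt_r Fx Fy].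
  by have [+ _] := ss (r, c) x (r, c') y Fx Fy; apply.
by have [_ +] := ss (r, c) x (r', c) y Fx Fy; apply.
Qed.

Definition exchange p q u v F : filling :=
  set_cell (set_cell F p.1 p.2 (false, v)) q.1 q.2 (true, u).

Definition switch_at p q u v F G : Prop :=
  [/\ adjacent p q, letter_at true F p u /\ letter_at false F q v,
      G = exchange p q u v F & forall b, semistandard b G].

Lemma switchP F G : switch F G <-> exists p q u v, switch_at p q u v F G.
Proof.
split=> [[r [c [r' [c' [u [v [adj Fuv eG [ssT ssF]]]]]]]]|].
  by exists (r, c), (r', c'), u, v; split=> // -[].
move=> [[r c] [[r' c'] [u [v [adj Fuv eG ss]]]]].
by exists r, c, r', c', u, v; split.
Qed.

Lemma adjacent_neq p q : adjacent p q -> p != q.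
Proof. by case: p q => [r c] [r' c'] [] [-> ->]; rewrite xpair_eqE; lia. Qed.

Section Exchange.

Variables (F : filling) (p q : nat * nat) (u v : nat).
Hypotheses (p_neq_q : p != q) (Fp : letter_at true F p u)
  (Fq : letter_at false F q v).

Let Fq' : cell_of (set_cell F p.1 p.2 (false, v)) q.1 q.2 = Some (false, v).
Proof.
rewrite (cell_of_set_cell _ _ _ Fp) -!surjective_pairing.
by rewrite eq_sym (negbTE p_neq_q).
Qed.

Lemma size_exchange : size (exchange p q u v F) = size F.
Proof. by rewrite (size_set_cell _ Fq') (size_set_cell _ Fp). Qed.

Lemma cell_of_exchange r c : cell_of (exchange p q u v F) r c =
  if (r, c) == q then Some (true, u) else if (r, c) == p then Some (false, v)
  else cell_of F r c.
Proof.
rewrite (cell_of_set_cell _ _ _ Fq') (cell_of_set_cell _ _ _ Fp).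
by rewrite -!surjective_pairing.
Qed.

Lemma letter_at_exchange b s x : letter_at b (exchange p q u v F) s x <->
  if s == (if b then q else p) then x = (if b then u else v)
  else s != (if b then p else q) /\ letter_at b F s x.
Proof.
rewrite /letter_at /has_letter cell_of_exchange -surjective_pairing.
case: b => /=; have [sE|s_q] := eqVneq s q.
- by split=> [[]|->].
- by have [_|s_p] := eqVneq s p; split=> // -[].
- by rewrite sE eq_sym (negbTE p_neq_q); split=> // -[].
- by have [_|_] := eqVneq s p; [split=> [[]|->]|split=> [|[]]].
Qed.

End Exchange.

(* Two letters of one origin that are moved by disjoint switches are compared
   through the positions in which at most one of them has moved. *)
Lemma ordered_after_moves (b : bool) s t s' t' x y :
  (if b then adjacent s t else adjacent t s) ->
  (if b then adjacent s' t' else adjacent t' s') ->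
  s != s' -> s != t' -> t != s' -> t != t' ->
  ordered s x s' y -> ordered s x t' y -> ordered t x s' y -> ordered t x t' y.
Proof.
case: s t s' t' => [r c] [r1 c1] [r' c'] [r1' c1'].
by rewrite /ordered /= !xpair_eqE; case: b => -[] [-> ->] [] [-> ->]; lia.
Qed.

Lemma letter_at_inj b b' F p x y :
  letter_at b F p x -> letter_at b' F p y -> b = b' /\ x = y.
Proof. by rewrite /letter_at /has_letter => -> [-> ->]. Qed.

Lemma switch_letter_at p q u v F G b s x : switch_at p q u v F G ->
  letter_at b G s x <->
  if s == (if b then q else p) then x = (if b then u else v)
  else s != (if b then p else q) /\ letter_at b F s x.
Proof.
by move=> [/adjacent_neq p_neq_q [Fp Fq] -> _]; apply: letter_at_exchange.
Qed.

Lemma switch_ordered p q u v F G b s x t y : switch_at p q u v F G ->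
  letter_at b G s x -> letter_at b G t y -> ordered s x t y.
Proof. by move=> [_ _ _ /(_ b)/semistandardP]; apply. Qed.

Section TwoSwitches.

Variables (F G G' : filling) (p q p' q' : nat * nat) (u v u' v' : nat).
Hypotheses (sw : switch_at p q u v F G) (sw' : switch_at p' q' u' v' F G').

Lemma switch_source_inj : p = p' -> q = q'.
Proof.
move=> eq_p; have [adj [Fp Fq] _ _] := sw; have [adj' [Fp' Fq'] _ _] := sw'.
have v_at_p : letter_at false G p v.
  by apply/(switch_letter_at _ _ _ sw); rewrite eqxx.
have v'_at_p : letter_at false G' p v'.
  by apply/(switch_letter_at _ _ _ sw'); rewrite eq_p eqxx.
have [//|q_neq_q'] := eqVneq q q'; exfalso.
have v'_at_q' : letter_at false G q' v'.
  apply/(switch_letter_at _ _ _ sw); rewrite eq_p [q' == p']eq_sym.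
  by rewrite (negbTE (adjacent_neq adj')) eq_sym q_neq_q'.
have v_at_q : letter_at false G' q v.
  apply/(switch_letter_at _ _ _ sw'); rewrite -eq_p [q == p]eq_sym.
  by rewrite (negbTE (adjacent_neq adj)).
have := switch_ordered sw v_at_p v'_at_q'.
have := switch_ordered sw' v'_at_p v_at_q.
move: q_neq_q'; rewrite /ordered.
by case: adj => ->; case: adj'; rewrite -eq_p => -> /=; rewrite ?eqxx //; lia.
Qed.

Lemma switch_target_inj : q = q' -> p = p'.
Proof.
move=> eq_q; have [adj [Fp Fq] _ _] := sw; have [adj' [Fp' Fq'] _ _] := sw'.
have u_at_q : letter_at true G q u.
  by apply/(switch_letter_at _ _ _ sw); rewrite eqxx.
have u'_at_q : letter_at true G' q u'.
  by apply/(switch_letter_at _ _ _ sw'); rewrite eq_q eqxx.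
have [//|p_neq_p'] := eqVneq p p'; exfalso.
have u'_at_p' : letter_at true G p' u'.
  apply/(switch_letter_at _ _ _ sw); rewrite eq_q.
  by rewrite (negbTE (adjacent_neq adj')) eq_sym p_neq_p'.
have u_at_p : letter_at true G' p u.
  apply/(switch_letter_at _ _ _ sw').
  by rewrite -eq_q (negbTE (adjacent_neq adj)).
have := switch_ordered sw u_at_q u'_at_p'.
have := switch_ordered sw u'_at_p' u_at_q.
have := switch_ordered sw' u'_at_q u_at_p.
have := switch_ordered sw' u_at_p u'_at_q.
move: p_neq_p' adj adj' eq_q; clear; rewrite /ordered.
case: p q p' q' => [r c] [r1 c1] [s d] [s1 d1] /=.
by rewrite xpair_eqE => ne [] [-> ->] [] [-> ->] []; lia.
Qed.

Hypotheses (p_neq_p' : p != p') (q_neq_q' : q != q').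
Hypothesis ssF : forall b, semistandard b F.

Let p_neq_q' : p != q'.
Proof.
have [_ [Fp _] _ _] := sw; have [_ [_ Fq'] _ _] := sw'.
apply: contraT => /negPn/eqP eq_pq'; rewrite eq_pq' in Fp.
by case: (letter_at_inj Fp Fq').
Qed.

Let q_neq_p' : q != p'.
Proof.
have [_ [_ Fq] _ _] := sw; have [_ [Fp' _] _ _] := sw'.
apply: contraT => /negPn/eqP eq_qp'; rewrite eq_qp' in Fq.
by case: (letter_at_inj Fp' Fq).
Qed.

Lemma exchangeC :
  exchange p q u v (exchange p' q' u' v' F) =
  exchange p' q' u' v' (exchange p q u v F).
Proof.
have [/adjacent_neq pq [Fp Fq] _ _] := sw.
have [/adjacent_neq pq' [Fp' Fq'] _ _] := sw'.
have Gp' : letter_at true (exchange p q u v F) p' u'.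
  apply/letter_at_exchange => //.
  by rewrite eq_sym (negbTE q_neq_p') eq_sym p_neq_p'.
have Gq' : letter_at false (exchange p q u v F) q' v'.
  apply/letter_at_exchange => //.
  by rewrite eq_sym (negbTE p_neq_q') eq_sym q_neq_q'.
have Gp : letter_at true (exchange p' q' u' v' F) p u.
  by apply/letter_at_exchange => //; rewrite (negbTE p_neq_q') p_neq_p'.
have Gq : letter_at false (exchange p' q' u' v' F) q v.
  by apply/letter_at_exchange => //; rewrite (negbTE q_neq_p') q_neq_q'.
apply: filling_ext => [|r c]; first by rewrite !size_exchange.
rewrite !cell_of_exchange //; case: eqP => [->|_].
  by rewrite (negbTE q_neq_q') (negbTE q_neq_p').
by case: eqP => [->|//]; rewrite (negbTE p_neq_q') (negbTE p_neq_p').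
Qed.

Let src b := if b then p else q.
Let dst b := if b then q else p.
Let src' b := if b then p' else q'.
Let dst' b := if b then q' else p'.
Let letter b := if b then u else v.
Let letter' b := if b then u' else v'.

Let src_neq_src' b : src b != src' b.
Proof. by rewrite /src /src'; case: b. Qed.

Let dst_neq_dst' b : dst b != dst' b.
Proof. by rewrite /dst /dst'; case: b. Qed.

Let src_neq_dst' b : src b != dst' b.
Proof. by rewrite /src /dst'; case: b. Qed.

Let dst_neq_src' b : dst b != src' b.
Proof. by rewrite /dst /src'; case: b. Qed.

Let F_src b : letter_at b F (src b) (letter b).
Proof. by have [_ [Fp Fq] _ _] := sw; case: b. Qed.

Let F_src' b : letter_at b F (src' b) (letter' b).
Proof. by have [_ [Fp Fq] _ _] := sw'; case: b. Qed.

Let G_dst b : letter_at b G (dst b) (letter b).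
Proof. by apply/(switch_letter_at _ _ _ sw); rewrite eqxx. Qed.

Let G'_dst' b : letter_at b G' (dst' b) (letter' b).
Proof. by apply/(switch_letter_at _ _ _ sw'); rewrite eqxx. Qed.

Let G_src' b : letter_at b G (src' b) (letter' b).
Proof.
apply/(switch_letter_at _ _ _ sw); rewrite -/(src b) -/(dst b) eq_sym.
by rewrite (negbTE (dst_neq_src' b)) eq_sym src_neq_src'.
Qed.

Let G'_src b : letter_at b G' (src b) (letter b).
Proof.
apply/(switch_letter_at _ _ _ sw'); rewrite -/(src' b) -/(dst' b).
by rewrite (negbTE (src_neq_dst' b)) src_neq_src'.
Qed.

Let ordered_dst b :
  ordered (dst b) (letter b) (dst' b) (letter' b) /\
  ordered (dst' b) (letter' b) (dst b) (letter b).
Proof.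
have moves : if b then adjacent (src b) (dst b) else adjacent (dst b) (src b).
  by have [adj _ _ _] := sw; rewrite /src /dst; case: (b).
have moves' :
    if b then adjacent (src' b) (dst' b) else adjacent (dst' b) (src' b).
  by have [adj _ _ _] := sw'; rewrite /src' /dst'; case: (b).
have ordF s x t y : letter_at b F s x -> letter_at b F t y -> ordered s x t y.
  by have /semistandardP := ssF b; apply.
have F_ord := ordF _ _ _ _ (F_src b) (F_src' b).
have F_ord' := ordF _ _ _ _ (F_src' b) (F_src b).
split; [apply: (ordered_after_moves moves moves' _ _ _ _ F_ord) |
        apply: (ordered_after_moves moves' moves _ _ _ _ F_ord')];
  rewrite // 1?eq_sym //.
- exact: switch_ordered sw' (G'_src b) (G'_dst' b).
- exact: switch_ordered sw (G_dst b) (G_src' b).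
- exact: switch_ordered sw (G_src' b) (G_dst b).
- exact: switch_ordered sw' (G'_dst' b) (G'_src b).
Qed.

Let letters_after_both b s x : letter_at b (exchange p' q' u' v' G) s x ->
  [\/ s = dst b /\ x = letter b, s = dst' b /\ x = letter' b
    | letter_at b G s x /\ letter_at b G' s x].
Proof.
have [/adjacent_neq pq' _ _ _] := sw'.
move=> /(letter_at_exchange pq' (G_src' true) (G_src' false)).
case: eqP => [-> ->|s_dst' [s_src' Gs]]; first by constructor 2.
move: (Gs) => /(switch_letter_at _ _ _ sw); case: eqP => [-> ->|_ [_ Fs]].
  by constructor 1.
by constructor 3; split=> //; apply/(switch_letter_at _ _ _ sw'); case: eqP.
Qed.

Lemma switch_at_commute : switch_at p' q' u' v' G (exchange p' q' u' v' G).
Proof.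
have [adj' _ _ _] := sw'; split=> // b; apply/semistandardP => s x t y.
have ordG s1 x1 t1 y1 := @switch_ordered _ _ _ _ _ _ b s1 x1 t1 y1 sw.
have ordG' s1 x1 t1 y1 := @switch_ordered _ _ _ _ _ _ b s1 x1 t1 y1 sw'.
have [ord ord'] := ordered_dst b.
have at_dst := G_dst b; have at_dst' := G'_dst' b.
move=> /letters_after_both[[-> ->]|[-> ->]|[Gs Gs']].
- by move=> /letters_after_both[[-> ->]|[-> ->]|[Gt _]] //; apply: ordG.
- by move=> /letters_after_both[[-> ->]|[-> ->]|[_ Gt']] //; apply: ordG'.
- move=> /letters_after_both[[-> ->]|[-> ->]|[Gt _]].
  + exact: ordG.
  + exact: ordG'.
  + exact: ordG.
Qed.

End TwoSwitches.

Lemma switch_diamond F G G' : (forall b, semistandard b F) ->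
  switch F G -> switch F G' -> G = G' \/ exists H, switch G H /\ switch G' H.
Proof.
move=> ssF /switchP[p [q [u [v sw]]]] /switchP[p' [q' [u' [v' sw']]]].
have [[_ [Fp Fq] eG _] [_ [Fp' Fq'] eG' _]] := (sw, sw').
have eq_switches : p = p' -> q = q' -> G = G'.
  move=> eq_p eq_q; rewrite -eq_p -eq_q in Fp' Fq' eG'.
  have [[_ eq_u] [_ eq_v]] := (letter_at_inj Fp Fp', letter_at_inj Fq Fq').
  by rewrite eG eG' eq_u eq_v.
have [eq_p|p_neq_p'] := eqVneq p p'.
  by left; apply: eq_switches (switch_source_inj sw sw' eq_p).
have [eq_q|q_neq_q'] := eqVneq q q'.
  by left; apply: eq_switches => //; apply: switch_target_inj sw sw' eq_q.
right; exists (exchange p' q' u' v' G); split; apply/switchP.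
  by exists p', q', u', v'; apply: switch_at_commute sw sw' _ _ ssF.
exists p, q, u, v; rewrite eG -(exchangeC sw sw') // -eG'.
by apply: switch_at_commute sw' sw _ _ ssF; rewrite eq_sym.
Qed.

Definition switches := clos_refl_trans filling switch.

Lemma switches_trans F G H : switches F G -> switches G H -> switches F H.
Proof. exact: rt_trans. Qed.

Lemma switch_semistandard F G b : switch F G -> semistandard b G.
Proof. by case/switchP=> [p [q [u [v [_ _ _]]]]]. Qed.

Lemma switches_semistandard F G : switches F G ->
  (forall b, semistandard b F) -> forall b, semistandard b G.
Proof.
elim=> {F G} [F G sw _ b|//|F G H _ IHFG _ IHGH /IHFG/IHGH //].
exact: switch_semistandard sw.
Qed.

Lemma switches_after_switch F G G' : (forall b, semistandard b F) ->
  switch F G -> switch_final F G' -> switches G G'.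
Proof.
move=> ssF sw [FG' G'_final]; have {}FG' := clos_rt_rt1n _ _ _ _ FG'.
elim: FG' ssF G sw G'_final => {F G'} [F|F F1 G' sw1 F1G' IH] ssF G sw G'_final.
  by case: G'_final; exists G.
have [<-|[H [sw1' sw']]] := switch_diamond ssF sw1 sw.
  exact: clos_rt1n_rt.
apply: switches_trans (rt_step _ _ _ _ sw') _.
by apply: IH sw1' G'_final => b; apply: switch_semistandard sw1.
Qed.

Lemma switch_final_unique F G G' : (forall b, semistandard b F) ->
  switch_final F G -> switch_final F G' -> G = G'.
Proof.
move=> ssF FG [FG' G'_final]; have {}FG' := clos_rt_rt1n _ _ _ _ FG'.
elim: FG' ssF FG G'_final => {F G'} [F|F F1 G' sw _ IH] ssF FG G'_final.
  have [F_to_G _] := FG; have := clos_rt_rt1n _ _ _ _ F_to_G.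
  by case=> // H ? sw _; case: G'_final; exists H.
apply: IH => //; first by move=> b; apply: switch_semistandard sw.
by split; [apply: switches_after_switch sw FG|case: FG].
Qed.

(** * Growth grids *)

Definition antitone (f : nat -> nat) := forall r, f r.+1 <= f r.

Lemma antitone_leq f r r' : antitone f -> r <= r' -> f r' <= f r.
Proof.
by move=> anti /subnK <-; elim: (r' - r) => // d; apply: leq_trans (anti _).
Qed.

(* A shape is the function giving the length of each row, and [hstrip f g] says
   that the skew shape g / f is a horizontal strip. *)
Definition hstrip (f g : nat -> nat) := forall r, f r <= g r /\ g r.+1 <= f r.

Lemma hstrip_antitone f g : hstrip f g -> antitone g.
Proof. by move=> fg r; have := fg r; lia. Qed.

(* In row r of the union h / f of two horizontal strips, the cells that are
   alone in their column are those of the columns from [free_start f h r] to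
   [free_end f h r], the latter excluded. *)
Definition free_start (f h : nat -> nat) r := maxn (h r.+1) (f r).

Definition free_end (f h : nat -> nat) r :=
  if r is r'.+1 then minn (h r) (f r') else h 0.

(* Switching the strips g / f and h / g exchanges, in each row, the numbers of
   their cells that are alone in their column. *)
Definition toggle (f g h : nat -> nat) r :=
  free_end f h r + free_start f h r - g r.

Definition cells_above (f : nat -> nat) r := \sum_(k < r) f k.

Lemma cells_aboveS f r : cells_above f r.+1 = cells_above f r + f r.
Proof. exact: big_ord_recr. Qed.

Section Toggle.

Variables f g h : nat -> nat.
Hypotheses (fg : hstrip f g) (gh : hstrip g h).

Lemma free_bounds r : free_start f h r <= g r <= free_end f h r.
Proof.
rewrite /free_start /free_end; have := gh r; have := fg r.
by case: r => [|r]; [lia|have := fg r; lia].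
Qed.

Lemma toggleE r : toggle f g h r + g r = free_end f h r + free_start f h r.
Proof. by have := free_bounds r; rewrite /toggle; lia. Qed.

Lemma toggle_bounds r : free_start f h r <= toggle f g h r <= free_end f h r.
Proof. by have := free_bounds r; have := toggleE r; lia. Qed.

Lemma hstrip_toggle_inner : hstrip f (toggle f g h).
Proof.
move=> r; have := toggle_bounds r; have := toggle_bounds r.+1.
by rewrite /free_start /free_end; lia.
Qed.

Lemma hstrip_toggle_outer : hstrip (toggle f g h) h.
Proof.
move=> r; have := toggle_bounds r; rewrite /free_start /free_end.
by have := gh r; case: r => [|r]; lia.
Qed.

Lemma cells_above_toggle r :
  cells_above (toggle f g h) r.+1 + cells_above g r.+1 =
  cells_above h r.+1 + cells_above f r + free_start f h r.
Proof.
elim: r => [|r IH]; rewrite !cells_aboveS.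
  by rewrite /cells_above !big_ord0; have := toggleE 0; rewrite /free_end; lia.
rewrite !cells_aboveS in IH; have := toggleE r.+1.
by rewrite /free_start /free_end in IH *; lia.
Qed.

End Toggle.

Lemma eq_toggle f g h f' g' h' : f =1 f' -> g =1 g' -> h =1 h' ->
  toggle f g h =1 toggle f' g' h'.
Proof.
move=> eqf eqg eqh r; rewrite /toggle /free_end /free_start.
by case: r => [|r]; rewrite ?eqf ?eqg ?eqh.
Qed.

(* In rows up to r the strip h / g has at most as many cells as g / f has in the
   rows before r, stated without subtraction. *)
Definition ballot_strips (f g h : nat -> nat) := forall r,
  cells_above h r.+1 + cells_above f r <= cells_above g r.+1 + cells_above g r.

Lemma ballot_strips_toggle f g0 g1 g2
    (f1 := toggle f g0 g1) (f2 := toggle f1 g1 g2) :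
  hstrip f g0 -> hstrip g0 g1 -> hstrip g1 g2 ->
  ballot_strips g0 g1 g2 -> ballot_strips f f1 f2.
Proof.
move=> fg0 g01 g12 ballot_g r.
have fg1 : hstrip f1 g1 by apply: hstrip_toggle_outer.
have := cells_above_toggle fg0 g01 r; have := cells_above_toggle fg1 g12 r.
rewrite -/f1 -/f2.
have := ballot_g r; have := ballot_g r.+1; rewrite !cells_aboveS.
case: r => [|r]; first by rewrite /cells_above !big_ord0 /free_start; lia.
have := cells_above_toggle fg0 g01 r.
rewrite -/f1 !cells_aboveS /free_start; lia.
Qed.

Lemma eq_of_cells_above_leq f g j : (forall r, f r <= g r) ->
  cells_above g j <= cells_above f j -> forall r, r < j -> g r = f r.
Proof.
move=> le_fg; elim: j => // j IH; rewrite !cells_aboveS => le_sum r.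
have le_j : cells_above f j <= cells_above g j by apply: leq_sum.
rewrite ltnS leq_eqVlt => /predU1P[->|lt_r]; first by have := le_fg j; lia.
by apply: IH lt_r; have := le_fg j; lia.
Qed.

(* A ballot tableau has its letters i + 1 in rows of index at least i. *)
Lemma ballot_chain_stable (f : nat -> nat -> nat) :
  (forall i, hstrip (f i) (f i.+1)) ->
  (forall i, ballot_strips (f i) (f i.+1) (f i.+2)) ->
  forall i r, r < i -> f i.+1 r = f i r.
Proof.
move=> chain ballot_f; elim=> // i IH.
have same_above : cells_above (f i.+1) i = cells_above (f i) i.
  by apply: eq_bigr => -[j lt_j] _; apply: IH.
apply: eq_of_cells_above_leq => [r|]; first by case: (chain i.+1 r).
by have := ballot_f i i; rewrite same_above; lia.
Qed.

(* In column m the m largest letters of U are left out: [u m] is the shape of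
   the others, and [t i] is the shape of U and of the letters of V up to i. *)
Fixpoint growth (u t : nat -> nat -> nat) i : nat -> nat -> nat :=
  if i is i'.+1 then
    fix column m := if m is m'.+1
      then toggle (growth u t i' m'.+1) (growth u t i' m') (column m')
      else t i'.+1
  else u.

Section Growth.

Variables u t : nat -> nat -> nat.
Hypotheses (u_chain : forall m, hstrip (u m.+1) (u m)).
Hypotheses (t_chain : forall i, hstrip (t i) (t i.+1)) (ut : u 0 =1 t 0).

Lemma growth0 i : growth u t i 0 =1 t i.
Proof. by case: i. Qed.

Lemma growthSS i m : growth u t i.+1 m.+1 =
  toggle (growth u t i m.+1) (growth u t i m) (growth u t i.+1 m).
Proof. by []. Qed.

Lemma hstrip_growth_next i :
  (forall m, hstrip (growth u t i m.+1) (growth u t i m)) ->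
  forall m, hstrip (growth u t i m) (growth u t i.+1 m).
Proof.
move=> row_i.
elim=> [|m IH]; first by move=> r; rewrite !growth0; apply: t_chain.
by rewrite growthSS; apply: hstrip_toggle_inner.
Qed.

Lemma hstrip_growthU i m : hstrip (growth u t i m.+1) (growth u t i m).
Proof.
elim: i m => [|i IH] m; first exact: u_chain.
by rewrite growthSS; apply: hstrip_toggle_outer; [|apply: hstrip_growth_next].
Qed.

Lemma hstrip_growthV i m : hstrip (growth u t i m) (growth u t i.+1 m).
Proof. by apply: hstrip_growth_next; apply: hstrip_growthU. Qed.

Lemma growth_leq i m m' r : m <= m' -> growth u t i m' r <= growth u t i m r.
Proof.
apply: (@antitone_leq (fun m => growth u t i m r)) => {}m.
by case: (hstrip_growthU i m r).
Qed.

Hypothesis t_ballot : forall i, ballot_strips (t i) (t i.+1) (t i.+2).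

Lemma ballot_growth m i :
  ballot_strips (growth u t i m) (growth u t i.+1 m) (growth u t i.+2 m).
Proof.
elim: m i => [|m IH] i.
  have cells0 j k : cells_above (growth u t j 0) k = cells_above (t j) k.
    by apply: eq_bigr => l _; rewrite growth0.
  by move=> r; rewrite !cells0; apply: t_ballot.
rewrite (growthSS i.+1) (growthSS i); apply: ballot_strips_toggle (IH i).
- exact: hstrip_growthU.
- exact: hstrip_growthV.
- exact: hstrip_growthV.
Qed.

Lemma growth_stableS m i r : r < i -> growth u t i.+1 m r = growth u t i m r.
Proof.
move: i r; apply: ballot_chain_stable => i; last exact: ballot_growth.
exact: hstrip_growthV.
Qed.

Lemma growth_stable m i r : r < i -> growth u t i m r = growth u t r.+1 m r.
Proof.
move=> /subnK <-; elim: (i - r.+1) => // d IH.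
by rewrite addSn growth_stableS //; lia.
Qed.

Lemma growth_low M i r : u M =1 (fun=> 0) -> i <= r -> growth u t i M r = 0.
Proof.
move=> uM; elim: i r => [|i IH] r; first by rewrite /= uM.
case: r => // r le_ir.
by have := (hstrip_growthV i M r).2; rewrite IH //; lia.
Qed.

End Growth.

Lemma eq_growth u t u' t' :
    (forall m, u m =1 u' m) -> (forall i, t i =1 t' i) ->
  forall i m, growth u t i m =1 growth u' t' i m.
Proof.
move=> eq_u eq_t; elim=> [|i IHi] // m.
elim: m => [|m IHm]; first exact: eq_t.
by rewrite (growthSS u t) (growthSS u' t'); apply: eq_toggle.
Qed.

Lemma growth_shift u t i m :
  growth u t i m.+1 =1 growth (fun m => u m.+1) (fun i => growth u t i 1) i m.
Proof.
elim: i m => [|i IHi] // m; elim: m => [|m IHm] //.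
by rewrite growthSS [X in _ =1 X]growthSS; apply: eq_toggle.
Qed.

(** * Adding a cell to the boundary of a growth grid *)

Definition pushed_row (f h : nat -> nat) b :=
  if b is b'.+1 then if f b' <= h b then b' else b else b.

Lemma free_sum_add_outer f h h' b r : (forall r, h' r = h r + (r == b)) ->
  free_end f h' r + free_start f h' r =
  free_end f h r + free_start f h r + (r == pushed_row f h b).
Proof.
rewrite /free_end /free_start => h'E; case: b h'E => [|b] h'E /=.
  by case: r => [|r]; rewrite !h'E; lia.
have [->|r_b1] := eqVneq r b.+1; first by rewrite !h'E; case: ifP; lia.
have [->|r_b] := eqVneq r b.
  by case: b h'E {r_b1} => [|b] h'E; rewrite !h'E; case: ifP; lia.
by case: r r_b1 r_b => [|r] r_b1 r_b; rewrite !h'E; case: ifP; lia.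
Qed.

Lemma free_sum_add_inner (inner : bool) f f' h a r :
  (forall r, f' r = f r + (inner && (r == a))) ->
  free_end f' h r + free_start f' h r =
  free_end f h r + free_start f h r + (inner && (r == a + (f a < h a.+1))).
Proof.
move=> f'E; rewrite /free_end /free_start.
have [->|r_a1] := eqVneq r a.+1; first by rewrite !f'E; lia.
have [->|r_a] := eqVneq r a.
  by case: a f'E {r_a1} => [|a] f'E; rewrite !f'E; lia.
by case: r r_a1 r_a => [|r] r_a1 r_a; rewrite !f'E; lia.
Qed.

Section ToggleAddCell.

(* The shapes f, g and h gain a cell in their rows a, c and b. When [inner] is
   false, only h gains a cell. *)
Variables (inner : bool) (f g h f' g' h' : nat -> nat) (a b c : nat).
Hypotheses (fg : hstrip f g) (gh : hstrip g h).
Hypotheses (fg' : hstrip f' g') (gh' : hstrip g' h').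
Hypotheses (f'E : forall r, f' r = f r + (inner && (r == a)))
           (g'E : forall r, g' r = g r + (inner && (r == c)))
           (h'E : forall r, h' r = h r + (r == b)).
Hypotheses (cE : c = a + (f a < g a)) (c_a : inner || (c == a)).
Hypothesis lt_bc : b < c + inner.
Hypothesis full_bc : forall r, b <= r < c -> h r.+1 = g r.

Definition toggled_row := if b == a.+1 then a else pushed_row f h b.

Lemma toggled_row_lt : toggled_row < a + inner.
Proof.
rewrite /toggled_row /pushed_row; case: (b) lt_bc => [|b'] /=; first by lia.
by do 2?case: ifP; lia.
Qed.

Let room : 0 < b -> b.-1 != c -> h b < g b.-1.
Proof.
case: (b) h'E => [|b'] // h'E' _ /= /negbTE b'_c; have [_] := gh' b'.
by rewrite g'E !h'E' eqxx b'_c andbF; clear; lia.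
Qed.

Let free_sum_added r : free_end f' h' r + free_start f' h' r =
  free_end f h r + free_start f h r + (inner && (r == c)) + (r == toggled_row).
Proof.
rewrite (free_sum_add_inner h' r f'E) (free_sum_add_outer f r h'E).
rewrite h'E /toggled_row.
have [ba|ba] := eqVneq b a.+1.
  have [-> c_a1] : inner /\ c = a.+1 by move: cE c_a lt_bc; clear -ba; lia.
  by rewrite ba /pushed_row c_a1; case: ifP; clear; lia.
have -> : inner && (r == a + (f a < h a.+1 + false)) = inner && (r == c).
  have [_ h_ga] := gh a; have := full_bc (r := a); move: h_ga ba cE c_a lt_bc.
  by clear; case: inner; lia.
by clear; lia.
Qed.

Lemma toggle_add_cell r :
  toggle f' g' h' r = toggle f g h r + (r == toggled_row).
Proof.
have := toggleE fg gh r; have := toggleE fg' gh' r.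
by rewrite free_sum_added g'E; clear; lia.
Qed.

Let free_start_full r : b <= r <= a -> free_start f h r = g r.
Proof.
move=> /andP[le_br le_ra]; have [f_g h_g] := (fg r, gh r).
have [lt_rc|ge_rc] := ltnP r c.
  by rewrite /free_start full_bc ?le_br //; apply/maxn_idPl; case: f_g.
have -> : r = a by move: cE ge_rc le_ra; clear; lia.
rewrite /free_start; have := fg a; have := gh a.
by move: cE ge_rc le_ra; clear; lia.
Qed.

Lemma toggled_row_bump :
  b = toggled_row + (toggle f g h toggled_row < h toggled_row).
Proof.
rewrite /toggled_row; have [ba|ba] := eqVneq b a.+1.
  have := room; rewrite ba => /(_ isT) /= h_lt.
  have := toggleE fg gh a; have := (fg a).1; rewrite /free_start /free_end.
  move: cE lt_bc h_lt; rewrite ba; clear.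
  by case: inner => /=; case: (a) => [|a']; lia.
have le_ba : b <= a by move: cE ba lt_bc; clear; case: inner; lia.
have := toggleE fg gh b; rewrite free_start_full ?leqnn // /pushed_row.
case Eb : b le_ba room => [|b'] le_ba room' /=; first by clear; lia.
case: ifP => f_le /=; last by have := (gh b'.+1).1; move: f_le; clear; lia.
have := toggleE fg gh b'; have h_lt : h b'.+1 < g b'.
  by apply: room' => //=; move: cE le_ba; clear; lia.
by rewrite /free_start /free_end; case: (b') h_lt f_le; clear; lia.
Qed.

Lemma toggle_full r : toggled_row <= r < a -> toggle f g h r.+1 = f r.
Proof.
rewrite /toggled_row; have [ba|ba] := eqVneq b a.+1; first by clear; lia.
have le_ba : b <= a by move: cE ba lt_bc; clear; case: inner; lia.
move=> /andP[le_r lt_ra]; have le_br : b <= r.+1.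
  move: le_r; rewrite /pushed_row.
  by case: (b) => [|b'] //; case: ifP; clear; lia.
have := toggleE fg gh r.+1; rewrite free_start_full ?le_br // /free_end.
suff -> : minn (h r.+1) (f r) = f r by clear; lia.
apply/minn_idPr; have [le_br'|lt_rb] := leqP b r.
  by rewrite full_bc ?le_br' ?(fg r).1 //; move: cE lt_ra; clear; lia.
have b_r : b = r.+1 by move: le_br lt_rb; clear; lia.
by move: le_r; rewrite b_r /pushed_row; case: ifP => //; clear; lia.
Qed.

End ToggleAddCell.

Fixpoint bump_path (g : nat -> nat -> nat) a j :=
  if j is j'.+1 then let r := bump_path g a j' in r + (g j' r < g j r) else a.

Section GrowthAddCell.

Variables (u t t' : nat -> nat -> nat) (n x : nat).
Hypotheses (u_chain : forall m, hstrip (u m.+1) (u m)) (ut : u 0 =1 t 0).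
Hypotheses (t_chain : forall i, hstrip (t i) (t i.+1))
           (t'_chain : forall i, hstrip (t' i) (t' i.+1)).
Hypotheses (n_gt0 : 0 < n) (x_gt0 : 0 < x).
Hypothesis t'E : forall i r, t' i r = t i r + ((x <= i) && (r == n.-1)).
Hypothesis t_out : forall i r, n <= r -> t i r = 0.
Hypothesis t_before : t x.-1 n.-1 = 0.

Let ut' : u 0 =1 t' 0.
Proof. by move=> r; rewrite t'E ut leqNgt x_gt0 addn0. Qed.

Lemma growth_before i m : i < x -> growth u t' i m =1 growth u t i m.
Proof.
elim: i m => [|i IHi] // m lt_ix.
elim: m => [|m IHm]; first by move=> r; rewrite /= t'E leqNgt lt_ix addn0.
by rewrite !growthSS; apply: eq_toggle => //; apply: IHi; apply: ltnW.
Qed.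

Let growth_out i m r : n <= r -> growth u t i m r = 0.
Proof.
move=> le_nr; apply/eqP; rewrite -leqn0 -(t_out i le_nr) -(growth0 ut i r).
exact: growth_leq.
Qed.

(* [s m] is the row of the cell gained by the shape in column m of line i. *)
Definition bump_rule i (s : nat -> nat) := forall m,
  s m = s m.+1 + (growth u t i m.+1 (s m.+1) < growth u t i m (s m.+1)).

Let growth_add_cell_next i s : x <= i.+1 -> s 0 = n.-1 + ~~ (x <= i) ->
    bump_rule i s -> (forall m, (x <= i) || (s m == s m.+1)) ->
    (forall m r,
      growth u t' i m r = growth u t i m r + ((x <= i) && (r == s m))) ->
  exists s', [/\ s' 0 = n.-1, bump_rule i.+1 s'
    & forall m r, growth u t' i.+1 m r = growth u t i.+1 m r + (r == s' m)].
Proof.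
move=> le_xi1 s0 s_bump s_const s_added.
pose s' := fix path m := if m is m'.+1
  then toggled_row (growth u t i m) (growth u t i.+1 m') (s m) (path m')
  else n.-1.
have fg m := hstrip_growthU u_chain t_chain ut i m.
have gh m := hstrip_growthV u_chain t_chain ut i m.
have fg' m := hstrip_growthU u_chain t'_chain ut' i m.
have gh' m := hstrip_growthV u_chain t'_chain ut' i m.
have inv m : [/\ s' m < s m + (x <= i),
    forall r, growth u t' i.+1 m r = growth u t i.+1 m r + (r == s' m)
  & forall r, s' m <= r < s m -> growth u t i.+1 m r.+1 = growth u t i m r].
  elim: m => [|m [lt_s' s'_added full]].
    split=> [|r|r]; first by rewrite s0 /=; case: leqP; lia.
      by rewrite (growth0 ut') (growth0 ut) t'E le_xi1.
    rewrite s0 /= => /andP[ge_r lt_r]; rewrite t_out ?(growth0 ut); last by lia.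
    have -> : r = n.-1 by lia.
    by have -> : i = x.-1 by lia.
  rewrite !growthSS /=; split; first exact: toggled_row_lt lt_s'.
    exact: toggle_add_cell (s_bump m) (s_const m) lt_s' full.
  exact: toggle_full (fg m) (gh m) (s_bump m) lt_s' full.
exists s'; split=> // m; last by case: (inv m).
have [lt_s' s'_added full] := inv m.
exact: toggled_row_bump (gh' m) (s_added m) s'_added (s_bump m) lt_s' full.
Qed.

Lemma growth_add_cell i : x <= i -> exists s,
  [/\ s 0 = n.-1, bump_rule i s
    & forall m r, growth u t' i m r = growth u t i m r + (r == s m)].
Proof.
move=> /subnK <-; elim: (i - x) => [|d [s [s0 s_bump s_added]]].
  rewrite -[in 0 + x](prednK x_gt0) add0n.
  have lt_x : x <= x.-1 = false by lia.
  apply: (@growth_add_cell_next x.-1 (fun=> n)); rewrite ?prednK ?lt_x //.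
  - by rewrite /= addn1 prednK.
  - by move=> m; rewrite /= !growth_out // addn0.
  - by move=> _; rewrite eqxx.
  - by move=> m r; rewrite addn0; apply: growth_before; rewrite prednK.
have le_x : x <= d + x by rewrite leq_addl.
by apply: growth_add_cell_next s_bump _ _; rewrite ?le_x ?s0 ?addn0 // leqW.
Qed.

Section LastColumn.

Variables M i : nat.
Hypotheses (uM : u M =1 (fun=> 0)) (le_xi : x <= i).
Hypotheses (t_ballot : forall i, ballot_strips (t i) (t i.+1) (t i.+2))
           (t'_ballot : forall i, ballot_strips (t' i) (t' i.+1) (t' i.+2)).

Let last_stable := growth_stable u_chain t_chain ut t_ballot M.
Let last_stable' := growth_stable u_chain t'_chain ut' t'_ballot M.

Let added_row_at_line_x s :
  (forall r, growth u t' x M r = growth u t x M r + (r == s)) -> s = x.-1.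
Proof.
move=> s_added; have := s_added s; rewrite eqxx.
have [lt_sx|ge_sx] := ltnP s x; last first.
  by rewrite (growth_low u_chain t'_chain) //; lia.
rewrite last_stable // last_stable' //.
have [lt_sx1|] := ltnP s.+1 x; last by lia.
by rewrite growth_before // => /eqP; rewrite -[X in X == _]addn0 eqn_add2l.
Qed.

Lemma added_row_last_column s :
  (forall r, growth u t' i M r = growth u t i M r + (r == s)) -> s = x.-1.
Proof.
move=> s_added; have [q [_ _ /(_ M) q_added]] := growth_add_cell (leqnn x).
have qE := added_row_at_line_x q_added; have lt_x : x.-1 < i by rewrite prednK.
have := s_added x.-1.
rewrite last_stable // last_stable' // prednK // q_added qE eqxx.
by case: eqP => [<-|_] //; lia.
Qed.

Lemma growth_add_cell_path (g := fun j => growth u t i (M - j))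
    (g' := fun j => growth u t' i (M - j)) (s := bump_path g x.-1) :
  s M = n.-1 /\ forall j r, j <= M -> g' j r = g j r + (r == s j).
Proof.
have [q [q0 q_bump q_added]] := growth_add_cell le_xi.
have sE j : j <= M -> s j = q (M - j).
  elim: j => [|j IH] le_jM.
    by rewrite subn0 (added_row_last_column (q_added M)).
  have -> : s j.+1 = s j + (g j (s j) < g j.+1 (s j)) by [].
  by rewrite (q_bump (M - j.+1)) IH ?(ltnW le_jM) // /g -(subnSK le_jM).
split=> [|j r le_jM]; first by rewrite sE // subnn.
by rewrite sE // /g' q_added.
Qed.

End LastColumn.

End GrowthAddCell.

(** * Fillings along lattice paths *)

Definition fill (z : nat -> nat) N (f : nat -> nat -> bool * nat) : filling :=
  mkseq (fun r => mkseq (f r) (z r)) N.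

Lemma cell_of_fill z N f r c : cell_of (fill z N f) r c =
  if (r < N) && (c < z r) then Some (f r c) else None.
Proof.
rewrite /cell_of; have [lt_r|ge_r] := ltnP r N; last first.
  by rewrite nth_default ?size_mkseq // onth0n.
rewrite nth_mkseq //; have [lt_c|ge_c] := ltnP c (z r).
  by rewrite onthE (nth_map (true, 0)) ?size_mkseq // nth_mkseq.
by rewrite onth_default ?size_mkseq.
Qed.

Lemma letter_at_fill b z N f p x : letter_at b (fill z N f) p x <->
  [/\ p.1 < N, p.2 < z p.1 & f p.1 p.2 = (b, x)].
Proof.
rewrite /letter_at /has_letter cell_of_fill.
have [lt_r|ge_r] := ltnP p.1 N; last by split=> [|[]].
have [lt_c|ge_c] := ltnP p.2 (z p.1); last by split=> [|[]].
by split=> [[<-]|[_ _ ->]].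
Qed.

Lemma eq_fill z z' N f f' : (forall r, r < N -> z r = z' r) ->
  (forall r c, r < N -> c < z r -> f r c = f' r c) -> fill z N f = fill z' N f'.
Proof.
move=> eq_z eq_f; apply: filling_ext => [|r c]; first by rewrite !size_mkseq.
rewrite !cell_of_fill; have [lt_r|//] := ltnP r N; rewrite -eq_z //.
by have [lt_c|//] := ltnP c (z r); rewrite eq_f.
Qed.

Lemma switch_fill z N f f' p q u v : adjacent p q ->
  q.1 < N -> p.2 < z p.1 -> q.2 < z q.1 ->
  f p.1 p.2 = (true, u) -> f q.1 q.2 = (false, v) ->
  (forall r c, f' r c = if (r, c) == q then (true, u)
                        else if (r, c) == p then (false, v) else f r c) ->
  (forall b, semistandard b (fill z N f')) -> switch (fill z N f) (fill z N f').
Proof.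
move=> adj q_N p_z q_z fp fq f'E ss; apply/switchP; exists p, q, u, v.
have p_N : p.1 < N by case: adj q_N => -> /=; [|apply: ltnW].
have Fp : letter_at true (fill z N f) p u by apply/letter_at_fill.
have Fq : letter_at false (fill z N f) q v by apply/letter_at_fill.
have p_q := adjacent_neq adj; split=> //.
apply: filling_ext => [|r c]; first by rewrite size_exchange // !size_mkseq.
rewrite cell_of_exchange // !cell_of_fill f'E.
case: eqP => [qE|_]; first by move: q_N q_z; rewrite -qE /= => -> ->.
by case: eqP => [pE|_] //; move: p_N p_z; rewrite -pE /= => -> ->.
Qed.

Lemma ordered_lt p x q y : x < y -> ordered p x q y.
Proof. by move=> lt_xy; split=> // _ _; apply: ltnW. Qed.

Lemma ordered_outside f p x q y : antitone f ->
  f p.1 <= p.2 -> q.2 < f q.1 -> ordered p x q y.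
Proof.
move=> anti p_out q_in; split=> [eq_row|eq_col lt_r].
  by rewrite -eq_row in q_in; lia.
by have := antitone_leq anti (ltnW lt_r); lia.
Qed.

Lemma ordered_hstrip f g p q x : antitone f -> hstrip f g ->
  f p.1 <= p.2 -> q.2 < g q.1 -> ordered p x q x.
Proof.
move=> anti fg p_out q_in; split=> [//|eq_col lt_r].
by have := antitone_leq (hstrip_antitone fg) lt_r; have [_] := fg p.1; lia.
Qed.

(* The vertex (i, j) stands for i letters of V and j letters of U. A lattice
   path is the word of its steps, [true] for U and [false] for V. *)
Definition step (v : nat * nat) (b : bool) :=
  if b then (v.1, v.2.+1) else (v.1.+1, v.2).

Definition coord (b : bool) (v : nat * nat) := if b then v.2 else v.1.

Definition path_end (w : seq bool) v := foldl step v w.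

Lemma coord_step b b' v : coord b (step v b') = coord b v + (b' == b).
Proof. by case: b; case: b'; rewrite /= ?addn0 ?addn1. Qed.

Definition set_coord (b : bool) (v : nat * nat) x :=
  if b then (v.1, x) else (x, v.2).

Lemma set_coord_id b v : set_coord b v (coord b v) = v.
Proof. by case: b; case: v. Qed.

Lemma set_coord_step b v x : set_coord b (step v b) x = set_coord b v x.
Proof. by case: b. Qed.

Lemma step_set_coord b v x : step (set_coord b v x) b = set_coord b v x.+1.
Proof. by case: b. Qed.

Lemma coord_path_end b w v : coord b (path_end w v) = coord b v + count_mem b w.
Proof.
elim: w v => [|b' w IH] v; first by rewrite addn0.
by rewrite /= IH coord_step addnA.
Qed.

Section LatticePath.

Variable L : nat * nat -> nat -> nat.
Hypothesis L_strip : forall v b, hstrip (L v) (L (step v b)).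

Fixpoint path_letter (w : seq bool) v r c : bool * nat :=
  if w is b :: w' then
    if c < L (step v b) r then (b, coord b (step v b))
    else path_letter w' (step v b) r c
  else (true, 0).

Lemma path_leq w v r : L v r <= L (path_end w v) r.
Proof.
elim: w v => //= b w IH v.
by apply: leq_trans (IH (step v b)); case: (L_strip v b r).
Qed.

Lemma path_antitone w v : antitone (L v) -> antitone (L (path_end w v)).
Proof.
by elim: w v => //= b w IH v _; apply: IH; apply: hstrip_antitone (L_strip v b).
Qed.

Lemma path_letter_cat w1 w2 v r c : L v r <= c -> path_letter (w1 ++ w2) v r c =
  if c < L (path_end w1 v) r then path_letter w1 v r c
  else path_letter w2 (path_end w1 v) r c.
Proof.
elim: w1 v => [|b w1 IH] v /= out_v; first by rewrite ltnNge out_v.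
have [lt_c|ge_c] := ltnP c (L (step v b) r); last exact: IH.
by rewrite (leq_trans lt_c) ?path_leq.
Qed.

Lemma path_letter_bounds w v r c b x :
  c < L (path_end w v) r -> L v r <= c -> path_letter w v r c = (b, x) ->
  coord b v < x <= coord b (path_end w v).
Proof.
elim: w v => [|b' w IH] v /=; first by lia.
move=> in_end out_v; have [in_b'|out_b'] := ltnP.
  by move=> [<- <-]; rewrite coord_path_end coord_step eqxx; lia.
move=> /IH; rewrite in_end out_b' coord_step => /(_ isT isT); lia.
Qed.

Lemma path_letter_ordered w v b p x q y : antitone (L v) ->
  L v p.1 <= p.2 < L (path_end w v) p.1 ->
  L v q.1 <= q.2 < L (path_end w v) q.1 ->
  path_letter w v p.1 p.2 = (b, x) -> path_letter w v q.1 q.2 = (b, y) ->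
  ordered p x q y.
Proof.
elim: w v => [|b' w IH] v anti /=; first by lia.
have anti' := hstrip_antitone (L_strip v b').
move=> /andP[p_out p_in] /andP[q_out q_in].
have [p_b'|p_b'] := ltnP p.2; have [q_b'|q_b'] := ltnP q.2.
- move=> [_ <-] [_ <-]; exact: ordered_hstrip (L_strip v b') p_out q_b'.
- move=> [<- <-] /path_letter_bounds-/(_ q_in q_b') lt_y.
  by apply: ordered_lt; case/andP: lt_y.
- by move=> _ _; apply: ordered_outside p_b' q_b'.
- by apply: IH; rewrite ?p_b' ?q_b'.
Qed.

Lemma path_letter_nseq b k v r c : L v r <= c < L (path_end (nseq k b) v) r ->
  exists x, [/\ path_letter (nseq k b) v r c = (b, x),
                coord b v < x <= coord b v + k
              & forall y, coord b v <= y ->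
                (x <= y) = (c < L (set_coord b v y) r)].
Proof.
have shape_leq w y y' : y <= y' ->
    L (set_coord b w y) r <= L (set_coord b w y') r.
  move=> /subnK <-; elim: (y' - y) => // d; move/leq_trans; apply.
  by rewrite addSn -step_set_coord; case: (L_strip (set_coord b w (d + y)) b r).
elim: k v => [|k IH] v /= /andP[out_v in_end]; first by lia.
have stepE : step v b = set_coord b v (coord b v).+1.
  by rewrite /set_coord; case: (b).
have [in_b|out_b] := ltnP c (L (step v b) r).
  exists (coord b (step v b)); rewrite coord_step eqxx addn1.
  split=> [//||y]; first by lia.
  rewrite leq_eqVlt => /predU1P[<-|lt_y]; last first.
    by rewrite lt_y (leq_trans in_b) // stepE shape_leq.
  by rewrite ltnn set_coord_id ltnNge out_v.
have [|x [xE x_bounds x_shape]] := IH (step v b); first by rewrite out_b.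
rewrite coord_step eqxx addn1 in x_bounds x_shape.
exists x; split=> [//||y]; first by lia.
rewrite leq_eqVlt => /predU1P[<-|lt_y]; last first.
  by rewrite x_shape // set_coord_step.
by rewrite set_coord_id ltnNge out_v leqNgt; case/andP: x_bounds => /ltnW ->.
Qed.

End LatticePath.

Section SortWord.

Variables (R : seq bool -> seq bool -> Prop) (m n : nat).
Hypotheses (R_refl : forall w, R w w)
           (R_trans : forall w1 w2 w3, R w1 w2 -> R w2 w3 -> R w1 w3).
Hypothesis R_swap : forall w1 w2 : seq bool,
  (count_mem true (w1 ++ w2)).+1 = m -> (count_mem false (w1 ++ w2)).+1 = n ->
  R (w1 ++ true :: false :: w2) (w1 ++ false :: true :: w2).

Let move_false k (w1 w2 : seq bool) :
  count_mem true (w1 ++ w2) + k = m -> (count_mem false (w1 ++ w2)).+1 = n ->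
  R (w1 ++ nseq k true ++ false :: w2) (w1 ++ false :: nseq k true ++ w2).
Proof.
elim: k w1 => [|k IH] w1 count_true count_false; first exact: R_refl.
apply: (R_trans (w2 := w1 ++ true :: false :: nseq k true ++ w2)).
  have := IH (rcons w1 true); rewrite -!cats1 -!catA; apply.
    by move: count_true; rewrite !count_cat /=; lia.
  by move: count_false; rewrite !count_cat.
apply: R_swap; rewrite !count_cat !count_nseq in count_true count_false *.
  by move: count_true => /=; lia.
by move: count_false => /=; lia.
Qed.

Lemma sort_word : R (nseq m true ++ nseq n false) (nseq n false ++ nseq m true).
Proof.
suff sort_suffix k w1 : w1 = nseq (n - k) false -> k <= n ->
    R (w1 ++ nseq m true ++ nseq k false) (w1 ++ nseq k false ++ nseq m true).
  by have := sort_suffix n [::]; rewrite subnn; apply.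
elim: k w1 => [|k IH] w1 w1E le_kn; first by rewrite cats0.
apply: (R_trans (w2 := w1 ++ false :: nseq m true ++ nseq k false)).
  apply: (move_false (k := m)); rewrite w1E count_cat !count_nseq //=; lia.
have := IH (rcons w1 false); rewrite -!cats1 -!catA; apply; last exact: ltnW.
by rewrite w1E -[[:: false]]/(nseq 1 false) -nseqD; congr nseq; lia.
Qed.

End SortWord.

Section Corner.

Variable L : nat * nat -> nat -> nat.
Hypothesis L_strip : forall v b, hstrip (L v) (L (step v b)).
Hypothesis L00 : forall r, L (0, 0) r = 0.
Variables (z : nat -> nat) (N : nat) (w1 w2 : seq bool).
Let v := path_end w1 (0, 0).
Let v' := step (step v true) false.
Let f := L v.
Let g := L (step v true).
Let h := L v'.
Let k := L (step v false).
Hypothesis kE : k =1 toggle f g h.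
Hypothesis zE : forall r, z r = L (path_end w2 v') r.
Hypothesis zN : forall r, N <= r -> z r = 0.

Let fg : hstrip f g := L_strip v true.
Let gh : hstrip g h := L_strip (step v true) false.
Let fk : hstrip f k := L_strip v false.
Let kh : hstrip k h := L_strip (step v false) true.

Let f_anti : antitone f.
Proof. by apply: path_antitone => // r; rewrite !L00. Qed.

Let h_anti : antitone h := hstrip_antitone gh.

Let z_anti : antitone z.
Proof. by move=> r; rewrite !zE; apply: path_antitone. Qed.

Let h_z r : h r <= z r.
Proof. by rewrite zE; apply: path_leq. Qed.

(* Between the shapes f and h the filling has the letters j + 1 of U and i + 1
   of V, where v = (i, j); the marking [m] tells them apart. *)
Definition corner_letter (m : nat -> nat -> bool) r c :=
  if c < f r then path_letter L w1 (0, 0) r c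
  else if c < h r then (m r c, coord (m r c) v')
  else path_letter L w2 v' r c.

Definition corner_fill m := fill z N (corner_letter m).

Lemma eq_corner_fill m m' : (forall r c, f r <= c < h r -> m r c = m' r c) ->
  corner_fill m = corner_fill m'.
Proof.
move=> eq_m; apply: eq_fill => // r c _ _; rewrite /corner_letter.
by have [//|f_c] := ltnP c; have [c_h|//] := ltnP c; rewrite eq_m ?f_c.
Qed.

Definition valid_marking (m : nat -> nat -> bool) :=
  forall r c, f r <= c < h r.+1 -> m r c != m r.+1 c.

Lemma corner_semistandard m b : valid_marking m ->
  semistandard b (corner_fill m).
Proof.
move=> m_valid; apply/semistandardP => p x q y.
move=> /letter_at_fill[_ p_z +] /letter_at_fill[_ q_z]; rewrite /corner_letter.
have inner r c a : c < f r -> path_letter L w1 (0, 0) r c = (b, a) ->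
  a <= coord b v.
  by move=> c_f /path_letter_bounds-/(_ c_f); rewrite L00 => /(_ isT)/andP[].
have outer r c a : h r <= c < z r -> path_letter L w2 v' r c = (b, a) ->
  coord b v' < a.
  by rewrite zE => /andP[h_c c_z] /path_letter_bounds-/(_ c_z h_c)/andP[].
have vv' : coord b v < coord b v' by rewrite !coord_step; case: (b); lia.
have [p_f|f_p] := ltnP p.2 (f p.1); have [q_f|f_q] := ltnP q.2 (f q.1).
- apply: path_letter_ordered => //; rewrite ?L00 //; by move=> r; rewrite !L00.
- move=> /(inner _ _ _ p_f) x_le; case: ltnP => [_ [mq <-]|h_q].
    by rewrite mq; apply/ordered_lt/(leq_ltn_trans x_le).
  by move=> /outer; rewrite h_q => /(_ q_z) lt_y; apply: ordered_lt; lia.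
- by move=> _ _; apply: ordered_outside f_p q_f.
have [p_h|h_p] := ltnP p.2 (h p.1); have [q_h|h_q] := ltnP q.2 (h q.1).
- case=> mp <- [mq <-]; rewrite mp mq; split=> // eq_c lt_r.
  have eq_q1 : q.1 = p.1.+1.
    apply/eqP; rewrite eqn_leq lt_r andbT leqNgt; apply/negP.
    by move=> /(antitone_leq h_anti); have := gh p.1.+1; have := fg p.1; lia.
  have := m_valid p.1 p.2; rewrite f_p -eq_q1 eq_c q_h => /(_ isT).
  by rewrite -{1}eq_c mp mq eqxx.
- move=> [mp <-] /outer; rewrite h_q mp => /(_ q_z); exact: ordered_lt.
- by move=> _ _; apply: ordered_outside h_p q_h.
- by apply: path_letter_ordered; rewrite ?h_p ?h_q // -zE.
Qed.

Lemma corner_switch (m m' : nat -> nat -> bool) p q : adjacent p q ->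
  valid_marking m' ->
  f p.1 <= p.2 < h p.1 -> f q.1 <= q.2 < h q.1 -> m p.1 p.2 -> ~~ m q.1 q.2 ->
  (forall r c, f r <= c < h r -> m' r c =
     if (r, c) == q then true else if (r, c) == p then false else m r c) ->
  switches (corner_fill m) (corner_fill m').
Proof.
move=> adj m'_valid /andP[f_p p_h] /andP[f_q q_h] mp mq m'E; apply: rt_step.
have p_z := leq_trans p_h (h_z p.1); have q_z := leq_trans q_h (h_z q.1).
apply: (switch_fill adj _ p_z q_z).
- by rewrite ltnNge; apply: contraL q_z => /zN ->.
- by rewrite /corner_letter ltnNge f_p p_h mp.
- by rewrite /corner_letter ltnNge f_q q_h (negbTE mq).
- move=> r c; rewrite /corner_letter; have [c_f|f_c] := ltnP c (f r).
    rewrite !ifN //; apply/eqP => rcE.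
      by move: f_p c_f; rewrite -rcE /= leqNgt => /negbTE->.
    by move: f_q c_f; rewrite -rcE /= leqNgt => /negbTE->.
  have [c_h|h_c] := ltnP c (h r); last first.
    rewrite !ifN //; apply/eqP => rcE.
      by move: p_h h_c; rewrite -rcE /= ltnNge => /negbTE->.
    by move: q_h h_c; rewrite -rcE /= ltnNge => /negbTE->.
  by rewrite m'E ?f_c //; do 2?case: eqP.
- by move=> b; apply: corner_semistandard.
Qed.

(* The pair of cells (r, c), (r + 1, c) is U over V unless (r, c) belongs to
   [flipped], and [word r] lists the cells of row r that are alone in their
   column. *)
Definition marking (flipped : seq (nat * nat)) (word : nat -> seq bool) r c :=
  if c < h r.+1 then ((r, c) \notin flipped)
  else if (0 < r) && (f r.-1 <= c) then (r.-1, c) \in flipped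
  else nth true (word r) (c - free_start f h r).

Lemma marking_valid flipped word : valid_marking (marking flipped word).
Proof.
move=> r c /andP[f_c c_h]; rewrite /marking c_h f_c /= ltnNge.
have -> : h r.+2 <= c by have := gh r.+1; have := fg r; lia.
by case: (_ \in _).
Qed.

Lemma marking_upper flipped word r c :
  c < h r.+1 -> marking flipped word r c = ((r, c) \notin flipped).
Proof. by rewrite /marking => ->. Qed.

Lemma marking_lower flipped word r c :
  f r <= c < h r.+1 -> marking flipped word r.+1 c = ((r, c) \in flipped).
Proof.
move=> /andP[f_c c_h]; rewrite /marking f_c /= ltnNge.
by have -> : h r.+2 <= c by have := gh r.+1; have := fg r; lia.
Qed.

Lemma marking_free flipped word r c : free_start f h r <= c < free_end f h r ->
  marking flipped word r c = nth true (word r) (c - free_start f h r).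
Proof.
rewrite /marking /free_start /free_end => free_c.
have -> : c < h r.+1 = false by lia.
by case: r free_c => [|r] /= free_c; rewrite ?ifF //; lia.
Qed.

Lemma eq_marking flipped flipped' word word' r c : f r <= c < h r ->
  (forall r1, f r1 <= c < h r1.+1 ->
     ((r1, c) \in flipped) = ((r1, c) \in flipped')) ->
  (free_start f h r <= c < free_end f h r ->
     nth true (word r) (c - free_start f h r) =
       nth true (word' r) (c - free_start f h r)) ->
  marking flipped word r c = marking flipped' word' r c.
Proof.
move=> /andP[f_c c_h] eq_flipped eq_word; rewrite /marking.
case: ltnP => [c_h1|h1_c]; first by rewrite eq_flipped ?f_c.
case: ifP => [/andP[r_gt0 f1_c]|free_c].
  by rewrite eq_flipped // prednK // f1_c.
apply: eq_word; rewrite /free_start /free_end.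
by case: r free_c c_h f_c h1_c => [|r] /=; lia.
Qed.

Lemma switches_flip word s :
  switches (corner_fill (marking [::] word)) (corner_fill (marking s word)).
Proof.
elim: s => [|[r c] s IH]; first exact: rt_refl.
apply: switches_trans IH _.
have [/andP[pair_rc new_rc]|old_rc] :=
    boolP ((f r <= c < h r.+1) && ((r, c) \notin s)); last first.
  rewrite (@eq_corner_fill (marking s word) (marking ((r, c) :: s) word)).
    exact: rt_refl.
  move=> r0 c' region; apply: eq_marking region _ _ => // r' pair'.
  rewrite inE; case: eqP => // -[r'E c'E].
  by move: old_rc; rewrite -r'E -c'E pair' negbK => ->.
have /andP[f_c c_h] := pair_rc.
apply: (@corner_switch _ _ (r, c) (r.+1, c)); first by right.
- exact: marking_valid.
- by rewrite /= f_c (leq_trans c_h).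
- by rewrite /= c_h andbT; have := fg r; have := fg r.+1; lia.
- by rewrite marking_upper.
- by rewrite marking_lower.
move=> r' c' /andP[f_c' c'_h] /=; rewrite /marking !inE !xpair_eqE.
have h_ge_f r1 : h r1.+2 <= f r1 by have := gh r1.+1; have := fg r1; lia.
have not_p : h r'.+1 <= c' -> (r' == r) && (c' == c) = false.
  move=> h1_c'; apply/andP => -[/eqP r'E /eqP c'E].
  by move: h1_c'; rewrite r'E c'E leqNgt c_h.
case: ltnP => [c'_h1|/not_p not_p'].
  rewrite [(r' == r.+1) && _](_ : _ = false); first by case: (_ && _).
  apply/andP => -[/eqP r'E /eqP c'E]; move: c'_h1; rewrite r'E c'E ltnNge.
  by rewrite (leq_trans (h_ge_f r) f_c).
rewrite not_p'; case: ifP => [/andP[r'_gt0 _]|/negbT free_c'].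
  by rewrite -(prednK r'_gt0) eqSS; case: (_ && _).
rewrite ifN //; apply: contra free_c' => /andP[/eqP-> /eqP->] /=; exact: f_c.
Qed.

Let a := free_start f h.
Let e := free_end f h.

Let free_region r c : a r <= c < e r -> f r <= c < h r.
Proof. by rewrite /a /e /free_start /free_end; case: r => [|r]; lia. Qed.

Definition set_word (word : nat -> seq bool) (r0 : nat) s r :=
  if r == r0 then s else word r.

Let row_fill flipped word r0 s :=
  corner_fill (marking flipped (set_word word r0 s)).

Lemma switches_free flipped word r0 s1 s2 :
  (size (s1 ++ s2)).+2 = e r0 - a r0 ->
  switches (row_fill flipped word r0 (s1 ++ true :: false :: s2))
           (row_fill flipped word r0 (s1 ++ false :: true :: s2)).
Proof.
rewrite size_cat => size_row; pose c0 := a r0 + size s1.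
have free0 : a r0 <= c0 < e r0 by rewrite /c0; lia.
have free1 : a r0 <= c0.+1 < e r0 by rewrite /c0; lia.
have c0a : c0 - a r0 = size s1 by rewrite addKn.
have c1a : c0.+1 - a r0 = (size s1).+1 by rewrite /c0; lia.
apply: (@corner_switch _ _ (r0, c0) (r0, c0.+1)); first by left.
- exact: marking_valid.
- exact: free_region.
- exact: free_region.
- by rewrite marking_free // c0a /set_word eqxx nth_cat ltnn subnn.
- by rewrite marking_free // c1a /set_word eqxx nth_cat ltnNge leqnSn subSnn.
move=> r c region; rewrite !xpair_eqE.
have [/andP[/eqP rE free_c]|not_free] := boolP ((r == r0) && (a r <= c < e r)).
  rewrite rE in free_c *.
  rewrite !marking_free // /set_word !eqxx /= -/(a r0) !nth_cat.
  have -> : (c == c0.+1) = (c - a r0 == (size s1).+1) by rewrite /c0; lia.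
  have -> : (c == c0) = (c - a r0 == size s1) by rewrite /c0; lia.
  move: (c - a r0) => i; have [lt_i|gt_i|->] := ltngtP i (size s1).
  - by rewrite ifN //; lia.
  - rewrite -(subnKC gt_i) addSn subSn ?leq_addr // addKn eqSS.
    by rewrite -[X in _ == X]addn0 eqn_add2l; case: (_ - _).
  - by rewrite subnn /= ltn_eqF.
rewrite !ifN; first apply: eq_marking region _ _ => // free_c.
- by rewrite /set_word; case: eqP not_free => // _ /negP[].
- by apply: contra not_free => /andP[/eqP-> /eqP->]; rewrite eqxx.
- by apply: contra not_free => /andP[/eqP-> /eqP->]; rewrite eqxx.
Qed.

Let initial_word r := nseq (g r - a r) true ++ nseq (e r - g r) false.
Let final_word r := nseq (e r - g r) false ++ nseq (g r - a r) true.

Let g_free r : a r <= g r <= e r := free_bounds fg gh r.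

Lemma switches_sort_row flipped word r0 :
  switches (row_fill flipped word r0 (initial_word r0))
           (row_fill flipped word r0 (final_word r0)).
Proof.
pose R s s' :=
  switches (row_fill flipped word r0 s) (row_fill flipped word r0 s').
apply: (@sort_word R) => [s|s1 s2 s3|s1 s2 count_true count_false]; rewrite /R.
- exact: rt_refl.
- exact: switches_trans.
apply: switches_free; rewrite -(count_predC (pred1 true)).
rewrite (@eq_count _ (predC (pred1 true)) (pred1 false)); last by case.
rewrite -addnS -addSn count_true count_false; have := g_free r0; lia.
Qed.

Lemma switches_sort_rows flipped :
  switches (corner_fill (marking flipped initial_word))
           (corner_fill (marking flipped final_word)).
Proof.
pose word K r := if r < K then final_word r else initial_word r.
have eq_word word1 word2 : (forall r, word1 r = word2 r) ->
    corner_fill (marking flipped word1) = corner_fill (marking flipped word2).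
  move=> eq_w; apply: eq_corner_fill => r c ?.
  by apply: eq_marking => //; rewrite eq_w.
suff sort_rows K : switches (corner_fill (marking flipped initial_word))
    (corner_fill (marking flipped (word K))).
  apply: switches_trans (sort_rows N) _.
  rewrite (@eq_corner_fill _ (marking flipped final_word)).
    exact: rt_refl.
  move=> r c region; apply: eq_marking region _ _ => // free_c.
  rewrite /word ifT // ltnNge; apply/negP => /zN.
  by have := h_z r; have := free_region free_c; lia.
elim: K => [|K IH]; first exact: rt_refl.
apply: switches_trans IH _.
rewrite (eq_word (word K) (set_word (word K) K (initial_word K))); last first.
  by move=> r; rewrite /set_word; case: eqP => // ->; rewrite /word ltnn.
rewrite (eq_word (word K.+1) (set_word (word K) K (final_word K))).
  exact: switches_sort_row.
by move=> r; rewrite /set_word /word ltnS leq_eqVlt; case: eqP => // ->.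
Qed.

Lemma marking_initial r c : f r <= c < h r ->
  marking [::] initial_word r c = (c < g r).
Proof.
move=> /andP[f_c c_h]; have := gh r; have := fg r; rewrite /marking => f_g g_h.
case: ltnP => [c_h1|h1_c]; first by rewrite in_nil; lia.
case: ifP => [/andP[r_gt0]|free_c].
  by have := fg r.-1; rewrite prednK // in_nil; lia.
have free : a r <= c < e r.
  rewrite /a /e /free_start /free_end.
  by case: r free_c c_h f_c h1_c {f_g g_h} => [|r] /=; lia.
have a_g_e := g_free r; rewrite nth_cat size_nseq !nth_nseq -/(a r).
have -> : (c - a r < g r - a r) = (c < g r) by lia.
by case: ltnP => // g_c; rewrite ifT //; lia.
Qed.

Lemma marking_final s r c : f r <= c < h r ->
  (forall r1, f r1 <= c < h r1.+1 -> (r1, c) \in s) ->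
  marking s final_word r c = ~~ (c < k r).
Proof.
move=> /andP[f_c c_h] flipped.
have := kh r; have := fk r; rewrite /marking => f_k k_h.
case: ltnP => [c_h1|h1_c]; first by rewrite flipped ?f_c //; lia.
case: ifP => [/andP[r_gt0 f1_c]|free_c].
  by rewrite flipped ?prednK ?f1_c //; have := fk r.-1; rewrite prednK //; lia.
have free : a r <= c < e r.
  rewrite /a /e /free_start /free_end.
  by case: r free_c c_h f_c h1_c {f_k k_h} => [|r] /=; lia.
have k_g : k r + g r = e r + a r by rewrite kE toggleE.
have a_g_e := g_free r; rewrite nth_cat size_nseq !nth_nseq -/(a r).
have -> : (c - a r < e r - g r) = (c < k r) by lia.
by case: ltnP => // k_c; rewrite ifT //; lia.
Qed.

Lemma corner_switches :
  switches (fill z N (path_letter L (w1 ++ true :: false :: w2) (0, 0)))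
           (fill z N (path_letter L (w1 ++ false :: true :: w2) (0, 0))).
Proof.
have -> : fill z N (path_letter L (w1 ++ true :: false :: w2) (0, 0)) =
    corner_fill (fun r c => c < g r).
  apply: eq_fill => // r c _ _.
  rewrite path_letter_cat ?L00 // -/v /corner_letter -/f.
  case: ifP => // _; rewrite /= -/g -/h -/v'; have := gh r.
  by case: ltnP => [c_g|g_c]; case: ltnP => // *; lia.
have -> : fill z N (path_letter L (w1 ++ false :: true :: w2) (0, 0)) =
    corner_fill (fun r c => ~~ (c < k r)).
  apply: eq_fill => // r c _ _.
  rewrite path_letter_cat ?L00 // -/v /corner_letter -/f.
  case: ifP => // _; rewrite /= -/k -/h -/v'; have := kh r.
  by case: ltnP => [c_k|k_c]; case: ltnP => // *; lia.
pose pairs := [seq (r, c) | r <- iota 0 N, c <- iota 0 (z 0)].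
rewrite (eq_corner_fill (m' := marking [::] initial_word)); last first.
  by move=> r c /marking_initial.
rewrite [X in switches _ X](eq_corner_fill (m' := marking pairs final_word)).
  exact: switches_trans (switches_flip _ _) (switches_sort_rows _).
move=> r c region; rewrite marking_final // => r1 /andP[_ c_h].
have c_z : c < z r1.
  by apply: leq_trans c_h _; apply: leq_trans (h_z r1); apply: h_anti.
apply: allpairs_f; rewrite mem_iota /= add0n.
  by rewrite ltnNge; apply: contraL c_z => /zN ->.
exact: leq_trans c_z (antitone_leq z_anti (leq0n r1)).
Qed.

End Corner.

Section PathSwitches.

Variable L : nat * nat -> nat -> nat.
Hypothesis L_strip : forall v b, hstrip (L v) (L (step v b)).
Hypothesis L00 : forall r, L (0, 0) r = 0.
Variables (N n M : nat).
Hypothesis L_toggle : forall v, v.2 < M -> L (step v false) =1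
  toggle (L v) (L (step v true)) (L (step (step v true) false)).
Hypothesis L_out : forall r, N <= r -> L (n, M) r = 0.

Let path_fill w := fill (L (n, M)) N (path_letter L w (0, 0)).

Lemma path_switches :
  switches (path_fill (nseq M true ++ nseq n false))
           (path_fill (nseq n false ++ nseq M true)).
Proof.
pose R w w' := switches (path_fill w) (path_fill w').
apply: (@sort_word R) => [w|w w' w''|w1 w2 count_true count_false]; rewrite /R.
- exact: rt_refl.
- exact: switches_trans.
have endE w : path_end w (0, 0) = (count_mem false w, count_mem true w).
  have := coord_path_end true w (0, 0); have := coord_path_end false w (0, 0).
  by case: (path_end _ _) => i j /= -> ->.
apply: corner_switches => //.
  by apply: L_toggle; rewrite endE /= -count_true count_cat ltnS leq_addr.
move=> r; rewrite -[step (step _ _) _]/(path_end [:: true; false] _).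
rewrite /path_end -!foldl_cat -/(path_end _ _) endE; congr (L (_, _) r).
  by rewrite -count_false !count_cat /= addnS.
by rewrite -count_true !count_cat /= addnS.
Qed.

End PathSwitches.

(** * Skew pairs and their shapes *)

Local Notation inner P r := (nth 0 P.1 r).
Local Notation row P r := (nth [::] P.2 r).
Local Notation count_le i := (count (fun y => y <= i)).

Lemma count_leS i s : count_le i.+1 s = count_le i s + count_mem i.+1 s.
Proof. by elim: s => //= y s ->; lia. Qed.

Lemma sorted_nth_le s i k : sorted leq s -> k < size s ->
  (nth 0 s k <= i) = (k < count_le i s).
Proof.
move=> s_sorted lt_k; have [lt_count|ge_count] := ltnP k (count_le i s).
  exact: (@nth_count_le _ _ i 0).
apply/negbTE; rewrite -ltnNge.
by apply: (@nth_count_gt _ _ i 0); rewrite // ge_count.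
Qed.

Lemma sorted_cat_filter i s : sorted leq s ->
  s = [seq y <- s | y <= i] ++ [seq y <- s | i < y].
Proof.
move=> s_sorted; rewrite (@sorted_filter_gt _ _ i s s_sorted).
by rewrite (@sorted_filter_le _ _ i s s_sorted) cat_take_drop.
Qed.

Lemma count_eq0 (a : pred nat) s : all (predC a) s -> count a s = 0.
Proof. by rewrite all_predC has_count -eqn0Ngt => /eqP. Qed.

Lemma is_partP s : reflect (antitone (nth 0 s) /\ 0 \notin s) (is_part s).
Proof.
apply: (iffP andP) => -[s_desc s_pos]; split=> //.
  move=> k; have [lt_k|ge_k] := ltnP k.+1 (size s); last first.
    by rewrite (nth_default _ ge_k).
  exact: (sortedP 0 s_desc).
by apply/(sortedP 0) => k _; apply: s_desc.
Qed.

Lemma nth_gt0 s k : 0 \notin s -> (0 < nth 0 s k) = (k < size s).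
Proof.
move=> s_pos; have [lt_k|ge_k] := ltnP k (size s); last by rewrite nth_default.
by rewrite lt0n; apply: contra s_pos => /eqP <-; apply: mem_nth.
Qed.

Lemma eq_is_part s s' : is_part s -> is_part s' -> nth 0 s =1 nth 0 s' ->
  s = s'.
Proof.
move=> /is_partP[_ s_pos] /is_partP[_ s'_pos] eq_s.
have le_size t t' : 0 \notin t -> nth 0 t =1 nth 0 t' -> size t <= size t'.
  by move=> t_pos eq_t; rewrite leqNgt -(nth_gt0 _ t_pos) eq_t nth_default.
apply: (@eq_from_nth _ 0) => [|k _]; last exact: eq_s.
by apply/eqP; rewrite eqn_leq !le_size.
Qed.

Lemma exists_part f n : antitone f -> (forall k, n <= k -> f k = 0) ->
  exists2 s, is_part s & nth 0 s =1 f.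
Proof.
elim: n f => [|n IH] f f_anti f_out.
  by exists [::] => // r; rewrite nth_nil f_out.
have [f0|f0_gt0] := posnP (f 0).
  exists [::] => // r; rewrite nth_nil; apply/esym/eqP.
  by rewrite -leqn0 -f0; apply: antitone_leq.
have [s s_part sE] :=
  IH (fun k => f k.+1) (fun k => f_anti k.+1) (fun k => f_out k.+1).
exists (f 0 :: s); last by case.
apply/is_partP; split; first by case=> [|k]; rewrite /= ?sE.
by rewrite inE negb_or neq_ltn f0_gt0 orTb; case/is_partP: s_part.
Qed.

Definition outer_shape (P : ypair) r := inner P r + size (row P r).

Definition glue_letter b (P : ypair) r c :=
  if c < inner P r then (b, r.+1) else (~~ b, nth 0 (row P r) (c - inner P r)).

Lemma glueE b P : glue b P = fill (outer_shape P) (size P.2) (glue_letter b P).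
Proof.
apply: (@eq_from_nth _ [::]); rewrite ?size_mkseq // => r lt_r.
rewrite !nth_mkseq //; apply: (@eq_from_nth _ (true, 0)).
  by rewrite size_cat size_nseq size_map size_mkseq.
rewrite size_cat size_nseq size_map => c lt_c.
rewrite nth_mkseq // nth_cat size_nseq /glue_letter nth_nseq.
by case: ltnP => // ge_c; rewrite (nth_map 0) //; lia.
Qed.

Lemma shape_glue b P : shape (glue b P) = mkseq (outer_shape P) (size P.2).
Proof.
rewrite glueE /shape -map_comp; apply: eq_map => r /=.
by rewrite size_mkseq.
Qed.

Lemma semistandard_glueN b b' P :
  semistandard b (glue b' P) -> semistandard (~~ b) (glue (~~ b') P).
Proof.
move=> /semistandardP ss; apply/semistandardP => p x q y.
suff flip_letter s a : letter_at (~~ b) (glue (~~ b') P) s a ->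
  letter_at b (glue b' P) s a.
  by move=> /flip_letter Px /flip_letter Py; apply: ss.
rewrite !glueE => /letter_at_fill[s_in_r s_in_c s_letter].
apply/letter_at_fill; split=> //; move: s_letter.
rewrite /glue_letter; case: ifP => _ [/esym eq_b <-]; congr (_, _).
  by move: eq_b => /(congr1 negb); rewrite !negbK.
by apply: negb_inj; rewrite eq_b negbK.
Qed.

Lemma semistandard_yamanouchi P : semistandard true (glue true P).
Proof.
apply/semistandardP => p x q y; rewrite glueE /glue_letter.
move=> /letter_at_fill[_ _ +] /letter_at_fill[_ _].
by do 2 case: ifP => // _; move=> [<-] [<-]; split=> [->|_]; rewrite ?ltnS.
Qed.

Definition shape_le (P : ypair) i r := inner P r + count_le i (row P r).

Section SkewPair.

Variable P : ypair.
Hypothesis P_skew : skew_pair P.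

Lemma skew_inner_antitone : antitone (nth 0 P.1).
Proof. by case: P_skew => /is_partP[]. Qed.

Lemma skew_inner_out r : size P.2 <= r -> inner P r = 0.
Proof.
case: P_skew => _ le_size _ _ _ le_r.
by rewrite nth_default // (leq_trans le_size).
Qed.

Lemma shape_le_out i r : size P.2 <= r -> shape_le P i r = 0.
Proof. by move=> le_r; rewrite /shape_le skew_inner_out // nth_default. Qed.

Lemma outer_shape_out r : size P.2 <= r -> outer_shape P r = 0.
Proof. by move=> le_r; rewrite /outer_shape skew_inner_out // nth_default. Qed.

Lemma outer_shape_nth r : outer_shape P r = nth 0 (shape (glue true P)) r.
Proof.
rewrite shape_glue.
have [lt_r|ge_r] := ltnP r (size P.2); first by rewrite nth_mkseq.
by rewrite outer_shape_out // nth_default // size_mkseq.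
Qed.

Lemma outer_shape_gt0 r : r < size P.2 -> 0 < outer_shape P r.
Proof.
case: P_skew => _ _ /is_partP[_ pos] _ _ lt_r.
by rewrite outer_shape_nth nth_gt0 // shape_glue size_mkseq.
Qed.

Lemma outer_shape_antitone : antitone (outer_shape P).
Proof.
by case: P_skew => _ _ /is_partP[anti _] _ _ r; rewrite !outer_shape_nth.
Qed.

Let letter_row r k : k < size (row P r) ->
  letter_at false (glue true P) (r, inner P r + k) (nth 0 (row P r) k).
Proof.
move=> lt_k; rewrite glueE; apply/letter_at_fill; split=> /=.
- by rewrite ltnNge; apply: contraL lt_k => /(nth_default [::])->.
- by rewrite ltn_add2l.
- by rewrite /glue_letter ltnNge leq_addr addKn.
Qed.

Let ordered_letters p x q y : letter_at false (glue true P) p x ->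
  letter_at false (glue true P) q y -> ordered p x q y.
Proof. by case: P_skew => _ _ _ _ /semistandardP; apply. Qed.

Lemma skew_row_sorted r : sorted leq (row P r).
Proof.
apply/(sortedP 0) => k lt_k.
have [+ _] := ordered_letters (letter_row (ltnW lt_k)) (letter_row lt_k).
by apply; rewrite //= ltn_add2l.
Qed.

Lemma skew_row_gt0 r : all (leq 1) (row P r).
Proof.
have [lt_r|ge_r] := ltnP r (size P.2); last by rewrite nth_default.
case: P_skew => _ _ _ pos _; apply/allP => y y_in; rewrite lt0n.
apply: contra pos => /eqP<-.
by apply/flattenP; exists (row P r); rewrite ?mem_nth.
Qed.

Lemma shape_le0 r : shape_le P 0 r = inner P r.
Proof.
rewrite /shape_le count_eq0 ?addn0 //; apply: sub_all (skew_row_gt0 r) => y.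
by rewrite /= -ltnNge.
Qed.

Lemma hstrip_shape_le i : hstrip (shape_le P i) (shape_le P i.+1).
Proof.
move=> r; split; first by rewrite /shape_le count_leS addnA leq_addr.
rewrite {1}/shape_le; set k := count_le _ _.
have [->|k_gt0] := posnP k.
  by rewrite addn0 (leq_trans (skew_inner_antitone r)) // leq_addr.
have lt_k : k.-1 < size (row P r.+1) by rewrite prednK ?count_size.
have le_i1 : nth 0 (row P r.+1) k.-1 <= i.+1.
  by rewrite sorted_nth_le ?skew_row_sorted // -/k prednK.
rewrite -(prednK k_gt0) addnS; set c := _ + k.-1; rewrite /shape_le.
have [c_inner|inner_c] := ltnP c (inner P r); first by rewrite ltn_addr.
have lt_c : c - inner P r < size (row P r).
  by rewrite ltn_subLR // (leq_trans _ (outer_shape_antitone r)) // ltn_add2l.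
have [_] := ordered_letters (letter_row lt_c) (letter_row lt_k).
rewrite /= subnKC // => /(_ erefl (ltnSn r)) lt_below.
rewrite -ltn_subLR // -sorted_nth_le ?skew_row_sorted // -ltnS.
exact: leq_trans lt_below le_i1.
Qed.

End SkewPair.

Lemma letter_at_take b F k p x : letter_at b (take k F) p x ->
  letter_at b F p x.
Proof.
rewrite /letter_at /has_letter /cell_of; have [lt_p|ge_p] := ltnP p.1 k.
  by rewrite nth_take.
by rewrite nth_default ?onth0n // size_take_min geq_min ge_p.
Qed.

Lemma semistandard_take b F k : semistandard b F -> semistandard b (take k F).
Proof.
move=> /semistandardP ss; apply/semistandardP => p x q y.
by move=> /letter_at_take Fp /letter_at_take Fq; apply: ss.
Qed.

Lemma glue_restrict b k P : glue b (restrict k P) = take k (glue b P).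
Proof.
rewrite /glue /= /mkseq -map_take take_iota size_take_min; apply/eq_in_map => r.
by rewrite mem_iota add0n leq_min => /and3P[_ lt_r _]; rewrite !nth_take.
Qed.

Lemma is_part_take k s : is_part s -> is_part (take k s).
Proof.
case/andP=> s_desc s_pos; rewrite /is_part take_sorted //.
by apply: contra s_pos => /mem_take.
Qed.

Lemma skew_pair_restrict k P : skew_pair P -> skew_pair (restrict k P).
Proof.
move=> [P_part le_size shape_part P_pos ss]; split; rewrite ?glue_restrict.
- exact: is_part_take.
- by rewrite /= !size_take_min leq_min geq_minl (leq_trans (geq_minr _ _)).
- by rewrite /shape map_take; apply: is_part_take.
- apply: contra P_pos => /flattenP[s /mem_take s_in y_in].
  by apply/flattenP; exists s.
- exact: semistandard_take.
Qed.

(** * Ballot tableaux *)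

Lemma reading_word_cat s1 s2 :
  reading_word (s1 ++ s2) = reading_word s2 ++ reading_word s1.
Proof. by rewrite /reading_word rev_cat flatten_cat. Qed.

Lemma ballot_suffix w1 w2 : ballot (w1 ++ w2) -> ballot w2.
Proof.
move=> w_ballot k i i_gt0; have := w_ballot (k + size w1) i i_gt0.
by rewrite -drop_drop drop_size_cat.
Qed.

Lemma ballot_take k T : ballot (reading_word T) ->
  ballot (reading_word (take k T)).
Proof.
by rewrite -{1}(cat_take_drop k T) reading_word_cat; apply: ballot_suffix.
Qed.

Lemma reading_word_take_row r T :
  reading_word (take r.+1 T) = nth [::] T r ++ reading_word (take r T).
Proof.
have [lt_r|ge_r] := ltnP r (size T).
  by rewrite (take_nth [::]) // -cats1 reading_word_cat /reading_word /= cats0.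
by rewrite nth_default // !take_oversize // ltnW.
Qed.

Lemma cells_above_count_mem v r T :
  cells_above (fun k => count_mem v (nth [::] T k)) r =
  count_mem v (reading_word (take r T)).
Proof.
elim: r => [|r IH]; first by rewrite /cells_above big_ord0 take0.
by rewrite cells_aboveS IH reading_word_take_row count_cat addnC.
Qed.

Lemma ballot_row i row w : sorted leq row -> 0 < i -> ballot (row ++ w) ->
  count_mem i.+1 (row ++ w) <= count_mem i w.
Proof.
move=> row_sorted i_gt0.
rewrite [in ballot _](sorted_cat_filter i row_sorted) -catA.
move=> /ballot_suffix/(_ 0 i i_gt0); rewrite drop0 !count_cat !count_filter.
rewrite (@eq_count _ (predI (pred1 i) _) pred0) ?count_pred0; last first.
  by move=> y /=; lia.
by rewrite (@eq_count _ (predI (pred1 i.+1) _) (pred1 i.+1)) // => y /=; lia.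
Qed.

Section BallotPair.

Variable P : ypair.
Hypothesis P_ballot : ballot (reading_word P.2).
Hypothesis row_sorted : forall r, sorted leq (row P r).

Let cells_above_shape_leS i r : cells_above (shape_le P i.+1) r =
  cells_above (shape_le P i) r + count_mem i.+1 (reading_word (take r P.2)).
Proof.
rewrite -cells_above_count_mem /cells_above -big_split.
by apply: eq_bigr => k _; rewrite /shape_le count_leS addnA.
Qed.

Lemma ballot_shape_le i :
  ballot_strips (shape_le P i) (shape_le P i.+1) (shape_le P i.+2).
Proof.
move=> r; rewrite (cells_above_shape_leS i.+1) (cells_above_shape_leS i r).
have := ballot_take r.+1 P_ballot; rewrite reading_word_take_row.
by move=> /(ballot_row (row_sorted r) (ltn0Sn i)); lia.
Qed.

Hypothesis P_chain : forall i, hstrip (shape_le P i) (shape_le P i.+1).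

Lemma ballot_row_leq r : all (geq r.+1) (row P r).
Proof.
apply/allP => y y_in; rewrite /= leqNgt; apply/negP => lt_y.
case: y y_in lt_y => // y y_in; rewrite ltnS => lt_r.
have := ballot_chain_stable P_chain ballot_shape_le lt_r.
rewrite /shape_le count_leS; have : 0 < count_mem y.+1 (row P r).
  by rewrite -has_count has_pred1.
lia.
Qed.

Lemma shape_le_outer n r : r < n -> shape_le P n r = outer_shape P r.
Proof.
move=> lt_r; congr (_ + _); apply/eqP; rewrite -all_count.
by apply: sub_all (ballot_row_leq r) => y /= /leq_trans; apply.
Qed.

Lemma count_mem_flatten_take k v : k < v ->
  count_mem v (flatten (take k P.2)) = 0.
Proof.
move=> lt_kv; apply/count_memPn/flattenP => -[s /(nthP [::])[r]].
rewrite size_take_min leq_min => /andP[lt_r _] <-; rewrite nth_take //.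
move=> /(allP (ballot_row_leq r)) /=.
by rewrite leqNgt (leq_ltn_trans lt_r).
Qed.

End BallotPair.

(** * Pairs as chains of shapes *)

Definition has_shapes M (g : nat -> nat -> nat) (Q : ypair) : Prop :=
  [/\ is_part Q.1, forall r, inner Q r = g 0 r,
      forall r, sorted leq (row Q r) /\ all (geq M) (row Q r)
    & forall j r, j <= M -> shape_le Q j r = g j r].

Lemma count_le_max M s : all (geq M) s -> count_le M s = size s.
Proof. by move=> s_le; apply/eqP; rewrite -all_count. Qed.

Lemma eq_sorted_count M s s' : sorted leq s -> sorted leq s' ->
  all (geq M) s -> all (geq M) s' ->
  (forall j, j <= M -> count_le j s = count_le j s') -> s = s'.
Proof.
move=> s_sorted s'_sorted s_le s'_le eq_count_le.
have eq_size : size s = size s'.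
  by rewrite -(count_le_max s_le) eq_count_le // count_le_max.
have nth_leq t t' k : sorted leq t -> sorted leq t' -> size t = size t' ->
    all (geq M) t' -> (forall j, j <= M -> count_le j t = count_le j t') ->
    k < size t -> nth 0 t k <= nth 0 t' k.
  move=> t_sorted t'_sorted eq_tt' t'_le eq_c lt_k.
  rewrite sorted_nth_le // eq_c.
    by rewrite -sorted_nth_le // -eq_tt'.
  by apply: (all_nthP 0 t'_le); rewrite -eq_tt'.
apply: (@eq_from_nth _ 0) => // k lt_k; apply/eqP; rewrite eqn_leq.
rewrite nth_leq //= nth_leq -?eq_size // => j le_j.
by rewrite eq_count_le.
Qed.

Lemma has_shapes_inj M g g' Q Q' : has_shapes M g Q -> has_shapes M g' Q' ->
  size Q.2 = size Q'.2 -> (forall j r, j <= M -> g j r = g' j r) -> Q = Q'.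
Proof.
case: Q Q' => [a H] [a' H'] [/= a_part aE rows gE] [/= a'_part a'E rows' g'E]
  eq_size eq_g.
congr (_, _); first by apply: eq_is_part => // r; rewrite aE a'E eq_g.
apply: (@eq_from_nth _ [::]) => // r _.
have [[row_sorted row_le] [row'_sorted row'_le]] := (rows r, rows' r).
apply: (@eq_sorted_count M) => // j le_j.
have := gE j r le_j; have := g'E j r le_j.
by rewrite /shape_le /= aE a'E !eq_g // => <- /addnI.
Qed.

Lemma has_shapes_row_gt0 M g Q r : has_shapes M g Q -> all (leq 1) (row Q r).
Proof.
case=> _ Q_inner _ Q_shape; rewrite -[leq 1]/(fun y => 0 < y).
have /eqP := Q_shape 0 r (leq0n M).
rewrite -Q_inner /shape_le -[X in _ == X]addn0 eqn_add2l.
rewrite eqn0Ngt -has_count -all_predC.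
by apply: sub_all => y /=; rewrite -ltnNge.
Qed.

Lemma has_shapes_widen M M' g Q : M <= M' -> has_shapes M g Q ->
  has_shapes M' (fun j => g (minn j M)) Q.
Proof.
move=> le_M [Q_part Q_inner Q_rows Q_shape]; split=> // [r|r|j r le_j].
- by rewrite min0n.
- have [row_sorted row_le] := Q_rows r; split=> //.
  by apply: sub_all row_le => y /leq_trans; apply.
rewrite -Q_shape ?geq_minr // /shape_le; congr (_ + _).
have [_ /allP row_le] := Q_rows r; apply: eq_in_count => y /row_le /= le_y.
by rewrite leq_min le_y andbT.
Qed.

Lemma has_shapes_chi n g Q : 0 < n -> has_shapes n g Q ->
  has_shapes n (fun j r => g j r + ((j == n) && (r == n.-1))) (chi n Q).
Proof.
move=> n_gt0 [Q_part Q_inner Q_rows Q_shape].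
have rowE r : row (chi n Q) r = row Q r ++ nseq (r == n.-1) n.
  by rewrite nth_set_nth /=; case: eqP => [->|_]; rewrite ?cats1 ?cats0.
split=> // [r|r|j r le_j]; first by rewrite Q_inner /= ltn_eqF // addn0.
  have [row_sorted row_le] := Q_rows r; rewrite rowE; split.
    case: eqP => _; rewrite ?cats0 // cats1.
    rewrite (sorted_pairwise leq_trans) pairwise_rcons row_le.
    by rewrite -(sorted_pairwise leq_trans).
  by rewrite all_cat row_le all_nseq /= leqnn orbT.
rewrite /shape_le rowE count_cat count_nseq addnA -/(shape_le Q j r) Q_shape //.
by rewrite mulnb [j == n]eqn_leq le_j.
Qed.

Lemma has_shapes_iter_chi m n g Q : 0 < n -> has_shapes n g Q ->
  has_shapes n (fun j r => g j r + m * ((j == n) && (r == n.-1)))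
    (iter m (chi n) Q).
Proof.
move=> n_gt0 Q_shapes.
elim: m => [|m /(has_shapes_chi n_gt0)[P_part P_in P_rows P_sh]].
  have [Q_part Q_inner Q_rows Q_shape] := Q_shapes.
  by split=> // [r|j r le_j]; rewrite mul0n addn0 ?Q_inner ?Q_shape.
by split=> // [r|j r le_j]; rewrite mulSnr addnA ?P_in ?P_sh.
Qed.

Lemma size_iter_chi m n Q : size (iter m (chi n) Q).2 =
  if 0 < m then maxn n.-1.+1 (size Q.2) else size Q.2.
Proof. by elim: m => //= -[|m] IH; rewrite size_set_nth IH // maxnA maxnn. Qed.

Definition steps_row (f : nat -> nat) M :=
  flatten (mkseq (fun j => nseq (f j.+1 - f j) j.+1) M).

Lemma steps_rowS f M :
  steps_row f M.+1 = steps_row f M ++ nseq (f M.+1 - f M) M.+1.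
Proof. by rewrite /steps_row mkseqS flatten_rcons. Qed.

Lemma steps_row_bounds f M : all (fun y => 0 < y <= M) (steps_row f M).
Proof.
elim: M => // M IH; rewrite steps_rowS all_cat all_nseq ltnSn orbT andbT.
by apply: sub_all IH => y /andP[-> /leqW].
Qed.

Lemma steps_row_sorted f M : sorted leq (steps_row f M).
Proof.
elim: M => // M IH; rewrite steps_rowS !(sorted_pairwise leq_trans) in IH *.
rewrite pairwise_cat IH /= -(sorted_pairwise leq_trans); apply/andP; split.
  apply/allrelP => y y' y_in /nseqP[-> _].
  by apply: leqW; case/andP: (allP (steps_row_bounds f M) y y_in).
by case: (_ - _) => //= d; elim: d => //= d ->; rewrite leqnn.
Qed.

Lemma count_le_steps_row f M j : (forall i, f i <= f i.+1) -> j <= M ->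
  f 0 + count_le j (steps_row f M) = f j.
Proof.
move=> f_mono; elim: M j => [|M IH] j; first by case: j => // _; rewrite addn0.
rewrite steps_rowS count_cat count_nseq addnA leq_eqVlt => /predU1P[->|lt_j].
  rewrite leqnn mul1n count_le_max; last first.
    by apply: sub_all (steps_row_bounds f M) => y /= /andP[_ /leqW].
  rewrite -(count_le_max (M := M)); last first.
    by apply: sub_all (steps_row_bounds f M) => y /= /andP[].
  by rewrite IH ?subnKC.
by rewrite leqNgt lt_j addn0 IH.
Qed.

Lemma exists_pair_of_shapes g M N : antitone (g 0) ->
  (forall j r, g j r <= g j.+1 r) -> (forall r, N <= r -> g M r = 0) ->
  exists2 Q, size Q.2 = N & has_shapes M g Q.
Proof.
move=> g_anti g_mono g_out.
have g_out_leq j r : j <= M -> N <= r -> g j r = 0.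
  move=> le_j /g_out g0; apply/eqP; rewrite -leqn0 -{}g0 -(subnKC le_j).
  elim: (M - j) => [|d IH]; first by rewrite addn0.
  by rewrite addnS (leq_trans IH).
have [a a_part aE] := exists_part g_anti (fun r => g_out_leq 0 r (leq0n M)).
pose H := mkseq (fun r => steps_row (g^~ r) M) N.
have rowE r : nth [::] H r = if r < N then steps_row (g^~ r) M else [::].
  case: ltnP => [lt_r|ge_r]; first by rewrite nth_mkseq.
  by rewrite nth_default // size_mkseq.
exists (a, H); first by rewrite size_mkseq.
split=> //= [r|j r le_j]; rewrite /shape_le /= rowE.
  case: ifP => // _; split; first exact: steps_row_sorted.
  by apply: sub_all (steps_row_bounds _ M) => y /= /andP[].
case: ltnP => [lt_r|ge_r]; last by rewrite aE !g_out_leq.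
by rewrite aE count_le_steps_row.
Qed.

(** * The result of switching *)

Lemma path_end_nseq k b v :
  path_end (nseq k b) v = set_coord b v (coord b v + k).
Proof.
elim: k v => [|k IH] v /=; first by rewrite addn0 set_coord_id.
by rewrite IH set_coord_step coord_step eqxx addn1 addSnnS.
Qed.

Section GluePath.

Variable L : nat * nat -> nat -> nat.
Hypothesis L_strip : forall v b, hstrip (L v) (L (step v b)).
Variables (P : ypair) (b : bool) (m n : nat).
Let corner := set_coord b (0, 0) m.
Hypothesis L_inner : forall x r, x <= m ->
  L (set_coord b (0, 0) x) r = if r < x then inner P r else 0.
Hypothesis L_outer : forall y r, y <= n ->
  L (set_coord (~~ b) corner y) r = shape_le P y r.
Hypothesis rows_sorted : forall r, sorted leq (row P r).
Hypothesis rows_le : forall r, all (geq n) (row P r).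
Hypothesis inner0 : forall r, shape_le P 0 r = inner P r.

Let L_origin r : L (0, 0) r = 0.
Proof. by have := L_inner r (leq0n m); rewrite /set_coord; case: (b). Qed.

Let coord_corner : coord (~~ b) corner = 0.
Proof. by rewrite /corner /set_coord; case: (b). Qed.

Let L_corner r : L corner r = inner P r.
Proof.
by rewrite -inner0 -(L_outer r (leq0n n)) -coord_corner set_coord_id.
Qed.

Let L_end r : L (path_end (nseq n (~~ b)) corner) r = outer_shape P r.
Proof.
by rewrite path_end_nseq coord_corner L_outer // /shape_le count_le_max.
Qed.

Lemma glue_path : glue b P =
  fill (outer_shape P) (size P.2)
    (path_letter L (nseq m b ++ nseq n (~~ b)) (0, 0)).
Proof.
have path_corner : path_end (nseq m b) (0, 0) = corner.
  by rewrite path_end_nseq /corner; case: (b).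
rewrite glueE; apply: eq_fill => // r c lt_r lt_c.
rewrite path_letter_cat ?L_origin // path_corner L_corner /glue_letter.
case: ltnP => [c_inner|inner_c].
  have [|x [-> /andP[x_gt0 x_le] x_shape]] :=
    @path_letter_nseq L L_strip b m (0, 0) r c.
    by rewrite L_origin path_corner L_corner.
  have [x_m x_min] : x <= m /\ forall y, y <= m ->
    (x <= y) = (c < if r < y then inner P r else 0).
    split; first by case: (b) x_le.
    by move=> y le_y; rewrite -L_inner // x_shape //; case: (b).
  have := x_min x x_m; rewrite leqnn; case: (ltnP r x) => // lt_rx _.
  have := x_min r.+1 (leq_trans lt_rx x_m); rewrite ltnSn c_inner => le_x.
  by congr (_, _); apply/eqP; rewrite eqn_leq le_x lt_rx.
have [|x [-> /andP[x_gt0 x_le] x_shape]] :=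
    @path_letter_nseq L L_strip (~~ b) n corner r c.
  by rewrite L_corner L_end inner_c.
rewrite coord_corner in x_gt0 x_le x_shape.
have lt_k : c - inner P r < size (row P r) by rewrite ltn_subLR.
have nth_x y : y <= n -> (x <= y) = (nth 0 (row P r) (c - inner P r) <= y).
  by move=> le_y; rewrite x_shape // L_outer // sorted_nth_le // ltn_subLR.
have nth_le : nth 0 (row P r) (c - inner P r) <= n.
  by apply: (all_nthP 0 (rows_le r)).
by congr (_, _); apply/eqP; rewrite eqn_leq -nth_x // leqnn nth_x // leqnn.
Qed.

End GluePath.

Lemma glue_false_final Q : antitone (nth 0 Q.1) ->
  ~ exists G, switch (glue false Q) G.
Proof.
move=> Q_anti [G /switchP[p [q [u [v [adj [Qp Qq] _ _]]]]]]; move: Qp Qq.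
rewrite glueE /glue_letter => /letter_at_fill[_ _ +] /letter_at_fill[_ _].
case: ltnP => // inner_p _; case: ltnP => // q_inner _; move: q_inner.
by have := Q_anti p.1; case: adj => -> /=; lia.
Qed.

(* The Yamanouchi tableau of shape mu restricted to its letters up to j. *)
Definition first_rows (mu : seq nat) j r := if r < j then nth 0 mu r else 0.

Lemma hstrip_first_rows mu j :
  antitone (nth 0 mu) -> hstrip (first_rows mu j) (first_rows mu j.+1).
Proof.
move=> mu_anti r; rewrite /first_rows; have := mu_anti r.
by case: (ltnP r j); case: (ltnP r j.+1); case: (ltnP r.+1 j.+1); lia.
Qed.

Lemma hstrip_first_rows_sub mu M m : antitone (nth 0 mu) ->
  hstrip (first_rows mu (M - m.+1)) (first_rows mu (M - m)).
Proof.
move=> mu_anti; have [lt_m|ge_m] := ltnP m M.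
  by rewrite -(subnSK lt_m); apply: hstrip_first_rows.
have -> : M - m.+1 = 0 by lia.
by have -> : M - m = 0 by lia.
Qed.

Section SwitchingResult.

Variables (P : ypair) (n M : nat).
Hypotheses (P_skew : skew_pair P) (P_ballot : ballot (reading_word P.2)).
Hypotheses (P_n : size P.2 <= n) (P_M : size P.1 <= M).

Let u m := first_rows P.1 (M - m).
Let t := shape_le P.
Let L v := growth u t v.1 (M - v.2).

Let u_chain m : hstrip (u m.+1) (u m) :=
  hstrip_first_rows_sub M m (skew_inner_antitone P_skew).

Let t_chain i : hstrip (t i) (t i.+1) := hstrip_shape_le P_skew i.

Let ut : u 0 =1 t 0.
Proof.
move=> r; rewrite /t shape_le0 // /u /first_rows subn0; case: ltnP => // ge_r.
by rewrite nth_default // (leq_trans P_M).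
Qed.

Let t_ballot i : ballot_strips (t i) (t i.+1) (t i.+2) :=
  ballot_shape_le P_ballot (skew_row_sorted P_skew) i.

Let growthU := hstrip_growthU u_chain t_chain ut.
Let growthV := hstrip_growthV u_chain t_chain ut.

Let growth_antitone i m : antitone (growth u t i m).
Proof. by case: m => [|m]; apply: hstrip_antitone (growthU i _). Qed.

Let L_strip v b : hstrip (L v) (L (step v b)).
Proof.
case: b; last exact: growthV.
rewrite /L /=; have [lt_v|ge_v] := ltnP v.2 M; first by rewrite -(subnSK lt_v).
have -> : M - v.2.+1 = 0 by lia.
have -> : M - v.2 = 0 by lia.
by move=> r; split=> //; apply: growth_antitone.
Qed.

Let L_toggle v : v.2 < M ->
  L (step v false) =1 toggle (L v) (L (step v true))
    (L (step (step v true) false)).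
Proof. by move=> lt_v r; rewrite /L /= -(subnSK lt_v). Qed.

Let L_outer_shape r : L (n, M) r = outer_shape P r.
Proof.
rewrite /L subnn growth0 //; have [lt_r|ge_r] := ltnP r (size P.2).
  apply: (shape_le_outer P_ballot _ t_chain) (leq_trans lt_r P_n).
  exact: skew_row_sorted.
by rewrite /t shape_le_out // outer_shape_out.
Qed.

Let rows_le r : all (geq n) (row P r).
Proof.
have [lt_r|ge_r] := ltnP r (size P.2); last by rewrite nth_default.
have := ballot_row_leq P_ballot (skew_row_sorted P_skew) t_chain r.
by apply: sub_all => y /= le_y; apply: leq_trans le_y (leq_trans lt_r P_n).
Qed.

Let L_V i r : i <= n -> L (i, 0) r = if r < i then L (n, 0) r else 0.
Proof.
move=> le_in; rewrite /L subn0; case: ltnP => [lt_ri|le_ir].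
  have stable := growth_stable u_chain t_chain ut t_ballot M.
  by rewrite stable // [RHS]stable // (leq_trans lt_ri).
by apply: (growth_low u_chain t_chain) => // k; rewrite /u subnn.
Qed.

Let L_origin r : L (0, 0) r = 0. Proof. by rewrite L_V. Qed.

Let glue_start : glue true P =
  fill (L (n, M)) (size P.2)
    (path_letter L (nseq M true ++ nseq n false) (0, 0)).
Proof.
rewrite (@glue_path L L_strip P true M n) //.
- exact: eq_fill.
- by move=> x r le_x; rewrite /L /= /u subKn.
- by move=> y r le_y; rewrite /L /= subnn growth0.
- exact: skew_row_sorted.
- exact: shape_le0.
Qed.

Section ResultPair.

Variable Q : ypair.
Hypotheses (Q_size : size Q.2 = size P.2)
  (Q_shapes : has_shapes M (fun j => L (n, j)) Q).

Let Q_inner r : inner Q r = L (n, 0) r. Proof. by case: Q_shapes. Qed.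

Let Q_outer r : outer_shape Q r = L (n, M) r.
Proof.
by have [_ _ /(_ r)[_ Q_le] <- //] := Q_shapes; rewrite /shape_le count_le_max.
Qed.

Let glue_end : glue false Q =
  fill (L (n, M)) (size P.2)
    (path_letter L (nseq n false ++ nseq M true) (0, 0)).
Proof.
have [_ _ Q_rows Q_shape] := Q_shapes.
rewrite (@glue_path L L_strip Q false n M) //.
- by rewrite Q_size; apply: eq_fill.
- by move=> x r le_x; rewrite Q_inner; apply: L_V.
- by move=> y r le_y; rewrite Q_shape.
- by move=> r; case: (Q_rows r).
- by move=> r; case: (Q_rows r).
- by move=> r; rewrite Q_shape.
Qed.

Let glue_switches : switches (glue true P) (glue false Q).
Proof.
rewrite glue_start glue_end; apply: path_switches => // r le_r.
by rewrite L_outer_shape outer_shape_out.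
Qed.

Let P_semistandard b : semistandard b (glue true P).
Proof. by case: b; [apply: semistandard_yamanouchi|case: P_skew]. Qed.

Let Q_skew : skew_pair Q.
Proof.
have [Q_part _ _ _] := Q_shapes; split=> //.
- have /is_partP[_ Q_pos] := Q_part.
  rewrite leqNgt -(nth_gt0 _ Q_pos) -leqNgt leqn0.
  have := outer_shape_out P_skew (leqnn (size P.2)).
  by rewrite -L_outer_shape -Q_outer Q_size /outer_shape; case: (inner Q _).
- rewrite shape_glue Q_size (@eq_mkseq _ _ (outer_shape P)) => [|r].
    by rewrite -(shape_glue true); case: P_skew.
  by rewrite Q_outer L_outer_shape.
- apply/negP => /flattenP[s /(nthP [::])[r _ <-]].
  by move/(allP (has_shapes_row_gt0 r Q_shapes)).
- apply: (@semistandard_glueN true false).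
  exact: switches_semistandard glue_switches P_semistandard true.
Qed.

Lemma rho1_has_shapes : rho1 P Q.
Proof.
split=> [|G]; first exact: Q_skew.
have Q_final : switch_final (glue true P) (glue false Q).
  by split=> //; apply: glue_false_final; case: Q_shapes => /is_partP[].
split=> [G_final|->//].
exact: switch_final_unique P_semistandard G_final Q_final.
Qed.

End ResultPair.

Lemma rho1_growth : exists Q,
  [/\ rho1 P Q, size Q.2 = size P.2
    & has_shapes M (fun j => growth u t n (M - j)) Q].
Proof.
have [|j r|r le_r|Q Q_size Q_shapes] :=
    @exists_pair_of_shapes (fun j => L (n, j)) M (size P.2).
- exact: growth_antitone.
- by case: (L_strip (n, j) true r).
- by rewrite L_outer_shape outer_shape_out.
by exists Q; split=> //; apply: rho1_has_shapes.
Qed.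

End SwitchingResult.

(** * Internal insertion *)

Lemma find_gt s v : sorted leq s -> find (fun y => v < y) s = count_le v s.
Proof.
move=> s_sorted; rewrite {1}(sorted_cat_filter v s_sorted) find_cat size_filter.
rewrite ifN; last by apply/hasPn => y; rewrite mem_filter; lia.
have : all (fun y => v < y) [seq y <- s | v < y] by apply: filter_all.
case: [seq _ <- s | _] => [|y t] /=; first by rewrite addn0.
by move=> /andP[-> _]; rewrite addn0.
Qed.

Section Bump.

Variables (v : nat) (s : seq nat).
Let k := count_le v s.
Let bumped := set_nth 0 s k v.

Lemma count_le_bump j :
  count_le j bumped + ((k < size s) && (nth 0 s k <= j)) =
  count_le j s + (v <= j).
Proof.
rewrite /bumped set_nthE; case: ltnP => [lt_k|ge_k]; last first.
  have -> : k - size s = 0 by apply/eqP; rewrite subn_eq0 count_size.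
  by rewrite count_cat /= !addn0.
rewrite -[in RHS](cat_take_drop k s) (drop_nth 0 lt_k) !count_cat /=; lia.
Qed.

Hypothesis s_sorted : sorted leq s.

Lemma sorted_bump : sorted leq bumped.
Proof.
apply/(sortedP 0) => i; rewrite size_set_nth => lt_i; rewrite !nth_set_nth /=.
have nth_le i' : i' < size s -> (nth 0 s i' <= v) = (i' < k).
  by apply: sorted_nth_le.
have := count_size (fun y => y <= v) s; rewrite -/k => le_k.
case: eqP => [i_k|i_nk]; case: eqP => [i1_k|i1_nk]; try lia.
- by have := nth_le i.+1; lia.
- by rewrite nth_le; lia.
- by apply: (sortedP 0 s_sorted); lia.
Qed.

Lemma row_insert_cons alpha r rows (cell := (r, nth 0 alpha r + k)) :
  row_insert alpha v r (s :: rows) =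
  if k < size s then
    let next := row_insert alpha (nth 0 s k) r.+1 rows in
    (bumped :: next.1, cell :: next.2)
  else (bumped :: rows, [:: cell]).
Proof.
rewrite /= find_gt // -/k; case: ltnP => // ge_k.
have eq_k : k = size s by apply/eqP; rewrite eqn_leq ge_k count_size.
by rewrite /bumped /cell eq_k set_nthE ltnn subnn cats1.
Qed.

End Bump.

Lemma row_insert_drop alpha v r H :
  row_insert alpha v r (drop r H) =
  row_insert alpha v r (nth [::] H r :: drop r.+1 H).
Proof.
have [lt_r|ge_r] := ltnP r (size H); first by rewrite (drop_nth [::]).
by rewrite !drop_oversize ?(leqW ge_r) // nth_default //= addn0.
Qed.

(* Removing the first entry of a row amounts to inserting a letter 0, which
   bumps that entry and joins the inner shape. *)
Lemma phi_route_insert i P (r := i.-1)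
    (ins := row_insert P.1 0 r (drop r P.2)) :
  0 < i -> inner_corner P r -> r <= size P.2 -> all (leq 1) (row P r) ->
  phi_route i P =
    Some (incr_nth P.1 r,
          take r P.2 ++ behead (head [::] ins.1) :: behead ins.1, ins.2).
Proof.
move=> i_gt0 corner le_r; rewrite /phi_route i_gt0 corner /= -/r.
rewrite /ins row_insert_drop; case: (nth [::] P.2 r) => [|x s] /=.
  move=> _; rewrite addn0 set_nthE; case: ltnP => // ge_r.
  have -> : r - size P.2 = 0 by lia.
  by rewrite drop_oversize ?(leqW ge_r) // take_oversize.
by case/andP=> x_gt0 _; rewrite x_gt0 /= addn0.
Qed.

Section BumpPath.

Variables (g : nat -> nat -> nat) (a M : nat).
Let s := bump_path g a.
Hypothesis g_mono : forall j r, j < M -> g j r <= g j.+1 r.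

Let sS j : s j.+1 = s j + (g j (s j) < g j.+1 (s j)).
Proof. by []. Qed.

Lemma bump_path_leq j j' : j <= j' -> s j <= s j'.
Proof.
by move=> /subnK <-; elim: (j' - j) => // d /leq_trans-> //; apply: leq_addr.
Qed.

Lemma bump_path_const v w : v <= w <= M -> s v = s w -> g v (s v) = g w (s v).
Proof.
move=> /andP[/subnKC <-]; elim: (w - v) => [|d IH]; first by rewrite addn0.
rewrite addnS => lt_M eq_s; have le_s := bump_path_leq (leqnSn (v + d)).
have eq_sd : s v = s (v + d).
  by apply/eqP; rewrite eqn_leq bump_path_leq ?leq_addr // eq_s le_s.
rewrite IH ?(ltnW lt_M) //.
apply/eqP; rewrite eqn_leq g_mono //= leqNgt; apply/negP.
move: eq_s; rewrite sS -eq_sd => /eqP.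
by rewrite -[X in X == _]addn0 eqn_add2l; case: ltnP.
Qed.

Definition row_entry v := forall j, j < v -> s j < s v.

Lemma row_entryP v j : row_entry v -> s v <= s j -> v <= j.
Proof.
by move=> entry le_s; rewrite leqNgt; apply/negP => /entry; rewrite ltnNge le_s.
Qed.

Lemma next_row_entry v : v <= M -> s v < s M -> exists w,
  [/\ v < w <= M, s w = (s v).+1, row_entry w, g v (s v) = g w.-1 (s v)
    & g w.-1 (s v) < g w (s v)].
Proof.
move=> le_v lt_s.
have leaves : exists w, (w <= M) && (s v < s w) by exists M; rewrite leqnn.
case: (ex_minnP leaves) => w /andP[w_M lt_w] w_min; exists w.
have lt_vw : v < w.
  by rewrite ltnNge; apply/negP => /bump_path_leq; rewrite leqNgt lt_w.
have before j : j < w -> s j <= s v.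
  move=> lt_j; rewrite leqNgt; apply/negP => lt_sj.
  have := w_min j; rewrite lt_sj andbT (leq_trans (ltnW lt_j)) //.
  by rewrite leqNgt lt_j => /(_ isT).
have w_gt0 : 0 < w by apply: leq_ltn_trans lt_vw.
have eq_w1 : s v = s w.-1.
  by apply/eqP; rewrite eqn_leq before ?prednK // bump_path_leq // -ltnS prednK.
have sw : s w = s v + (g w.-1 (s v) < g w (s v)).
  by rewrite -{1 3}(prednK w_gt0) sS -eq_w1.
have jump : g w.-1 (s v) < g w (s v).
  by move: lt_w; rewrite sw; case: (_ < g w _); rewrite // addn0 ltnn.
have sw1 : s w = (s v).+1 by rewrite sw jump addn1.
split; rewrite ?lt_vw //.
  by move=> j /before; rewrite sw1 ltnS.
by apply: bump_path_const; rewrite // -ltnS prednK // lt_vw; lia.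
Qed.

Definition on_bump_path (p : nat * nat) :=
  exists2 v, v <= M & row_entry v /\ p = (s v, g v (s v)).

End BumpPath.

(* The cells lie inside the shapes [g j], in those rows in which or below which
   the path [s] passes. *)
Definition left_of_path M (g : nat -> nat -> nat) s (cells : seq (nat * nat)) :=
  forall p j, p \in cells -> j <= M -> p.1 <= s j -> p.2 < g j p.1.

Section SuccessivePaths.

Variables (M a a' : nat) (g g' : nat -> nat -> nat).
Let s := bump_path g a.
Let s' := bump_path g' a'.
Hypothesis g'E : forall j r, j <= M -> g' j r = g j r + (r == s j).

Lemma bump_path_below j : a' <= a -> j <= M -> s' j <= s j.
Proof.
move=> le_a; elim: j => // j IH lt_j; have := IH (ltnW lt_j).
have sS : s j.+1 = s j + (g j (s j) < g j.+1 (s j)) by [].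
have s'S : s' j.+1 = s' j + (g' j (s' j) < g' j.+1 (s' j)) by [].
rewrite leq_eqVlt s'S => /predU1P[eq_s|lt_s].
  rewrite eq_s !g'E ?(ltnW lt_j) // sS eqxx leq_add2l.
  by case: (g j (s j) < g j.+1 (s j)) / ltnP => /=; case: eqP; lia.
by rewrite sS; move: lt_s; clear; lia.
Qed.

Hypothesis g'_mono : forall j j' r, j <= j' -> g' j r <= g' j' r.

Lemma left_of_own_path cells :
  (forall p, p \in cells -> on_bump_path g a M p) -> left_of_path M g' s cells.
Proof.
move=> on_path p j /on_path[v le_v [entry ->]] le_j le_s /=.
have le_vj := row_entryP entry le_s; apply: leq_trans (g'_mono _ le_vj).
by rewrite g'E // eqxx addn1.
Qed.

Lemma left_of_next_path cells s'' :
  left_of_path M g s'' cells -> (forall j, j <= M -> s j <= s'' j) ->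
  left_of_path M g' s cells.
Proof.
move=> left le_s p j p_in le_j le_p; rewrite g'E // ltn_addr //.
by apply: left => //; apply: leq_trans le_p (le_s j le_j).
Qed.

Lemma disjoint_path_left cells cells' s'' :
  left_of_path M g s'' cells -> (forall j, j <= M -> s j <= s'' j) ->
  (forall p, p \in cells' -> on_bump_path g a M p) ->
  disjoint_routes cells' cells.
Proof.
move=> left le_s on_path; apply/hasPn => p p_in.
apply/negP => /on_path[v le_v [_ eq_p]].
have := left p v p_in le_v; rewrite eq_p /= ltnn => absurd.
by have := absurd (le_s v le_v).
Qed.

End SuccessivePaths.

Section PhiPath.

Variables (n M x : nat) (g : nat -> nat -> nat) (P : ypair).
Let s := bump_path g x.-1.
Hypotheses (x_gt0 : 0 < x) (n_gt0 : 0 < n) (P_shapes : has_shapes M g P).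
Hypotheses (P_size : n.-1 <= size P.2 <= n) (sM : s M = n.-1).

Let P_inner r : inner P r = g 0 r. Proof. by case: P_shapes. Qed.

Let P_sorted r : sorted leq (row P r).
Proof. by case: P_shapes => _ _ /(_ r)[]. Qed.

Let P_le r : all (geq M) (row P r).
Proof. by case: P_shapes => _ _ /(_ r)[]. Qed.

Let P_shape r j : j <= M -> g 0 r + count_le j (row P r) = g j r.
Proof. by rewrite -P_inner; case: P_shapes => _ _ _; apply. Qed.

Let g_mono j r : j < M -> g j r <= g j.+1 r.
Proof.
move=> lt_j; rewrite -(P_shape r (ltnW lt_j)) -(P_shape r lt_j).
by rewrite leq_add2l count_leS leq_addr.
Qed.

Let s_mono := @bump_path_leq g x.-1.

Let s0 : s 0 = x.-1. Proof. by []. Qed.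

Let s_lt_n j : j <= M -> s j < n.
Proof. by move=> le_j; rewrite -(prednK n_gt0) ltnS -sM; apply: s_mono. Qed.

Let path_stops v : v <= M -> s v = s M ->
  count_le v (row P (s v)) = size (row P (s v)).
Proof.
move=> le_v eq_s; rewrite -(count_le_max (P_le _)).
apply: (@addnI (g 0 (s v))); rewrite !P_shape //.
by apply: (bump_path_const g_mono); rewrite ?le_v ?leqnn.
Qed.

Let path_bumps v (k := count_le v (row P (s v))) : v <= M -> s v < s M ->
  exists2 w, k < size (row P (s v)) /\ nth 0 (row P (s v)) k = w
    & [/\ v < w <= M, s w = (s v).+1 & row_entry g x.-1 w].
Proof.
move=> le_v lt_s.
have [w [/andP[lt_vw le_w] sw entry_w]] := next_row_entry g_mono le_v lt_s.
have shape_w1 := P_shape (s v) (leq_trans (leq_pred w) le_w).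
rewrite -(P_shape _ le_v) -shape_w1 -(P_shape _ le_w) => /addnI eq_k.
rewrite ltn_add2l => lt_k.
rewrite -eq_k -/k in lt_k; exists w; last by rewrite lt_vw.
have lt_size : k < size (row P (s v)) := leq_trans lt_k (count_size _ _).
split=> //; apply/eqP; rewrite eqn_leq sorted_nth_le // lt_k /=.
rewrite -(prednK (leq_ltn_trans (leq0n v) lt_vw)) ltnNge sorted_nth_le //.
by rewrite -eq_k -/k ltnn.
Qed.

Definition row_added r (row' : seq nat) :=
  [/\ sorted leq row', all (geq M) row'
    & forall j, j <= M -> g 0 r + count_le j row' = g j r + (r == s j)].

Let all_set_nth k v t : all (geq M) t -> k <= size t -> v <= M ->
  all (geq M) (set_nth 0 t k v).
Proof.
move=> /(all_nthP 0) t_le le_k le_v.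
apply/(all_nthP 0) => i; rewrite size_set_nth => lt_i.
by rewrite nth_set_nth /=; case: eqP => // ne_i; apply: t_le; lia.
Qed.

Lemma row_added_bump v : v <= M -> row_entry g x.-1 v ->
  row_added (s v) (set_nth 0 (row P (s v)) (count_le v (row P (s v))) v).
Proof.
move=> le_v entry; split.
- exact: sorted_bump.
- by apply: all_set_nth => //; apply: count_size.
move=> j le_j; rewrite -(P_shape _ le_j).
have := count_le_bump v (row P (s v)) j.
have [eq_s|ne_s] := eqVneq (s v) (s M).
  rewrite path_stops // ltnn addn0 => ->; rewrite addnA.
  congr (_ + nat_of_bool _).
  apply/idP/eqP => [le_vj|eq_sj]; last first.
    by apply: row_entryP entry _; rewrite -/s eq_sj.
  by apply/eqP; rewrite eqn_leq s_mono // eq_s s_mono.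
have lt_s : s v < s M by rewrite ltn_neqAle ne_s s_mono.
have [w [lt_size nth_w] [/andP[lt_vw le_w] sw entry_w]] := path_bumps le_v lt_s.
rewrite lt_size nth_w /=; have -> : (s v == s j) = (v <= j < w).
  apply/eqP/andP => [eq_sj|[le_vj lt_jw]].
    split; first by apply: row_entryP entry _; rewrite -/s eq_sj.
    by rewrite ltnNge; apply/negP => /(s_mono); rewrite -/s sw -eq_sj ltnn.
  by apply/eqP; rewrite eqn_leq s_mono // -ltnS -sw entry_w.
lia.
Qed.

Lemma row_insert_path v (ins := row_insert P.1 v (s v) (drop (s v) P.2)) :
  v <= M -> row_entry g x.-1 v ->
  [/\ size ins.1 = n - s v,
      forall k, k < n - s v -> row_added (s v + k) (nth [::] ins.1 k),
      ins.2 != [::] /\ (last (0, 0) ins.2).1 = n.-1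
    & forall p, p \in ins.2 -> on_bump_path g x.-1 M p].
Proof.
rewrite /ins {ins}; have [d] := ubnP (s M - s v).
elim: d v => // d IH v le_d le_v entry.
have added := row_added_bump le_v entry.
have cell_v : on_bump_path g x.-1 M
    (s v, inner P (s v) + count_le v (row P (s v))).
  by exists v => //; rewrite P_inner P_shape.
rewrite row_insert_drop row_insert_cons //.
have [eq_s|ne_s] := eqVneq (s v) (s M).
  have n_sv : n - s v = 1 by rewrite eq_s sM; lia.
  rewrite (path_stops le_v eq_s) in added cell_v *.
  rewrite ltnn n_sv /= drop_oversize; last first.
    by rewrite eq_s sM prednK //; case/andP: P_size.
  split=> //; first by case=> // _; rewrite addn0.
    by split=> //; rewrite eq_s.
  by move=> p; rewrite inE => /eqP->.
have lt_s : s v < s M by rewrite ltn_neqAle ne_s s_mono.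
have [w [lt_size nth_w] [/andP[lt_vw le_w] sw entry_w]] := path_bumps le_v lt_s.
have [|size_ins rows_ins [ins_neq0 last_ins] path_ins] := IH w _ le_w entry_w.
  by rewrite -/s sw; lia.
rewrite lt_size nth_w -sw /=; split.
- by rewrite size_ins -/s sw; move: lt_s; rewrite sM; lia.
- case=> [|k] lt_k /=; first by rewrite addn0.
  by rewrite -addSnnS -sw; apply: rows_ins; rewrite -/s sw; lia.
- by split=> //; case: (_.2) ins_neq0 last_ins.
by move=> p; rewrite inE => /predU1P[->|/path_ins].
Qed.

Variable g' : nat -> nat -> nat.
Hypotheses (g'E : forall j r, j <= M -> g' j r = g j r + (r == s j))
           (g'_anti : antitone (g' 0)).

Let inner_incr r : nth 0 (incr_nth P.1 x.-1) r = g' 0 r.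
Proof. by rewrite nth_incr_nth P_inner g'E //= eq_sym addnC. Qed.

Let is_part_incr : is_part (incr_nth P.1 x.-1).
Proof.
apply/is_partP; split=> [r|]; first by rewrite !inner_incr.
have /is_partP[_ P_pos] : is_part P.1 by case: P_shapes.
apply/negP => /(nthP 0)[r lt_r]; rewrite inner_incr => g'0.
have lt_xr : x.-1 < r.
  rewrite ltnNge; apply/negP => /(antitone_leq g'_anti).
  by rewrite g'0 g'E // eqxx addn1.
move/eqP: g'0; rewrite g'E // -P_inner addn_eq0 => /andP[/eqP inner_r0 _].
move: lt_r; rewrite size_incr_nth; case: ifP => _; last first.
  by rewrite ltnS leqNgt lt_xr.
by rewrite -(nth_gt0 r P_pos) inner_r0.
Qed.

Let inner_corner_path : inner_corner P x.-1.
Proof.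
rewrite /inner_corner is_part_incr andbT /in_skew !P_inner.
have := g'_anti x.-2; rewrite !g'E // s0.
by case: (x.-1) => [|y] /=; rewrite ?eqxx; lia.
Qed.

Let ins := row_insert P.1 0 x.-1 (drop x.-1 P.2).
Let H' := take x.-1 P.2 ++ behead (head [::] ins.1) :: behead ins.1.

Let entry0 : row_entry g x.-1 0. Proof. by move=> j; rewrite ltn0. Qed.

Let x_lt_n : x.-1 < n. Proof. by rewrite -s0 s_lt_n. Qed.

Let x_le_size : x.-1 <= size P.2.
Proof. by move: x_lt_n P_size; clear; lia. Qed.

Let row_ok r (row' : seq nat) := (sorted leq row' /\ all (geq M) row') /\
  forall j, j <= M -> g' 0 r + count_le j row' = g' j r.

Let row_ok_below r : r != x.-1 -> (forall j, j <= M -> (r == s j) = false) ->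
  row_ok r (row P r).
Proof.
move=> ne_r not_path; split=> // j le_j.
by rewrite !g'E // s0 (negbTE ne_r) not_path // !addn0 P_shape.
Qed.

Let row_ok_behead row' : row_added x.-1 row' -> row_ok x.-1 (behead row').
Proof.
case=> row'_sorted row'_le row'_count.
have count0 : count_le 0 row' = 1.
  by apply: (@addnI (g 0 x.-1)); rewrite row'_count // s0 eqxx.
case: row' row'_sorted row'_le row'_count count0 => // y t.
move=> yt_sorted /andP[_ t_le] yt_count count0.
have := sorted_nth_le 0 yt_sorted (ltn0Sn _).
rewrite count0 leqn0 /= => /eqP y0.
split; first by split=> //; apply: path_sorted yt_sorted.
by move=> j le_j; rewrite !g'E // s0 eqxx -yt_count //= y0 leq0n -addnA.
Qed.

Let H'_row r : row_ok r (nth [::] H' r).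
Proof.
have [size_ins rows_ins _ _] := row_insert_path (leq0n M) entry0.
rewrite s0 -/ins in size_ins rows_ins; rewrite /H' nth_cat size_takel //.
have [lt_r|gt_r|->] := ltngtP r x.-1.
- rewrite nth_take //; apply: row_ok_below; first by rewrite ltn_eqF.
  by move=> j le_j; rewrite ltn_eqF // (leq_trans lt_r) // -s0 s_mono.
- rewrite -subnSK //= nth_behead subnSK //; have [lt_rn|ge_rn] := ltnP r n.
    have [|row_sorted row_le row_count] := rows_ins (r - x.-1).
      by rewrite ltn_sub2r.
    split=> // j le_j; rewrite !g'E // s0 gtn_eqF // addn0.
    by rewrite subnKC ?(ltnW gt_r) // in row_count; rewrite row_count.
  have row_nil : row P r = [::].
    by rewrite nth_default // (leq_trans _ ge_rn) //; case/andP: P_size.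
  rewrite nth_default ?size_ins ?leq_sub2r // -row_nil; apply: row_ok_below.
    by rewrite gtn_eqF.
  by move=> j le_j; rewrite gtn_eqF // (leq_trans (s_lt_n le_j)).
rewrite subnn /= -nth0; apply: row_ok_behead; rewrite -[x.-1]addn0.
by apply: rows_ins; rewrite subn_gt0.
Qed.

Lemma phi_route_path : exists P' route,
  [/\ phi_route x P = Some (P', route), size P'.2 = n, has_shapes M g' P',
      (last (0, 0) route).1 = n.-1
    & forall p, p \in route -> on_bump_path g x.-1 M p].
Proof.
have [size_ins _ [_ last_ins] path_ins] := row_insert_path (leq0n M) entry0.
exists (incr_nth P.1 x.-1, H'), ins.2; split=> //.
- apply: phi_route_insert x_gt0 inner_corner_path x_le_size _.
  exact: has_shapes_row_gt0 P_shapes.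
- rewrite size_cat size_takel //= size_behead size_ins s0.
  by move: x_lt_n; clear; lia.
split=> //= [r|j r le_j]; first by have [] := H'_row r.
by rewrite /shape_le /= inner_incr; have [_ ->] := H'_row r.
Qed.

End PhiPath.

(** * The last row *)

Lemma phi_word_cat w1 w2 P :
  phi_word (w1 ++ w2) P = obind (phi_word w1) (phi_word w2 P).
Proof.
rewrite /phi_word foldr_cat; elim: w1 => [|x w1 IH] /=; first by case: foldr.
by rewrite IH; case: (foldr _ _ w2).
Qed.

Lemma phi_word_nseq k n P :
  phi_word (nseq k n) P = iter k (obind (phi n)) (Some P).
Proof. by elim: k => //= k <-. Qed.

Lemma phi_word_routes_cat w1 w2 P P' : phi_word w2 P = Some P' ->
  phi_word_routes (w1 ++ w2) P = phi_word_routes w1 P' ++ phi_word_routes w2 P.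
Proof.
move=> w2_P; elim: w1 => //= x w1 ->; rewrite phi_word_cat w2_P /=.
by case: obind => [[]|].
Qed.

Lemma sorted_split_max n s : sorted leq s -> all (fun y => 0 < y <= n) s ->
  s = [seq y <- s | 0 < y < n] ++ nseq (count_mem n s) n.
Proof.
move=> s_sorted s_bounds.
rewrite {1}(sorted_cat_filter n.-1 s_sorted); congr (_ ++ _).
  by apply: eq_in_filter => y /(allP s_bounds); lia.
have -> : [seq y <- s | n.-1 < y] = [seq y <- s | y == n].
  by apply: eq_in_filter => y /(allP s_bounds); lia.
by rewrite -size_filter; apply/all_pred1P/filter_all.
Qed.

Section LastRow.

Variables (n : nat) (P0 : ypair).
Hypotheses (n_gt0 : 0 < n) (P0_skew : skew_pair P0).
Hypotheses (P0_ballot : ballot (reading_word P0.2)) (P0_size : size P0.2 = n).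

Let R := row P0 n.-1.
Let M := n.-1.
Let u m := first_rows P0.1 (M - m).

(* The last row of T is replaced by a suffix W, moved to column 0. *)
Definition last_row_pair (W : seq nat) : ypair :=
  (take n.-1 P0.1, rcons (take n.-1 P0.2) W).

Let size_take_rows : size (take n.-1 P0.2) = n.-1.
Proof. by rewrite size_takel // P0_size leq_pred. Qed.

Lemma last_row_pair_row W r : row (last_row_pair W) r =
  if r == n.-1 then W else row P0 r.
Proof.
rewrite /= nth_rcons size_take_rows; case: ltngtP => [lt_r|gt_r|//].
  by rewrite nth_take.
by rewrite nth_default // P0_size; lia.
Qed.

Lemma last_row_pair_shape W i r :
  shape_le (last_row_pair W) i r =
  if r == n.-1 then count_le i W else shape_le P0 i r.
Proof.
rewrite /shape_le last_row_pair_row /=; case: ltngtP => [lt_r|gt_r|->].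
- by rewrite nth_take.
- rewrite nth_default ?size_take_min ?geq_min ?(ltnW gt_r) //.
  by rewrite (skew_inner_out P0_skew) // P0_size; lia.
- by rewrite nth_default ?size_take_min ?geq_min ?leqnn.
Qed.

Section Suffix.

Variables W1 W : seq nat.
Hypothesis RE : R = W1 ++ W.

Lemma last_row_suffix_gt0 : all (leq 1) W.
Proof.
by have := skew_row_gt0 P0_skew n.-1; rewrite -/R RE all_cat => /andP[].
Qed.

Lemma last_row_suffix_sorted : sorted leq W.
Proof.
by have := skew_row_sorted P0_skew n.-1; rewrite -/R RE => /cat_sorted2[].
Qed.

Lemma hstrip_last_row_pair i :
  hstrip (shape_le (last_row_pair W) i) (shape_le (last_row_pair W) i.+1).
Proof.
move=> r; have [sub strip] := hstrip_shape_le P0_skew i r.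
rewrite !last_row_pair_shape; split.
  by case: eqP => _ //; rewrite count_leS leq_addr.
have [r1E|_] := eqVneq r.+1 n.-1; last first.
  by case: eqP => // ->; rewrite (shape_le_out P0_skew) // P0_size prednK.
rewrite ifN; last by rewrite -r1E ltn_eqF.
apply: leq_trans strip.
by rewrite /shape_le r1E -/R RE count_cat addnA leq_addl.
Qed.

Lemma ballot_last_row_pair i :
  ballot_strips (shape_le (last_row_pair W) i)
    (shape_le (last_row_pair W) i.+1) (shape_le (last_row_pair W) i.+2).
Proof.
apply: ballot_shape_le => [|r]; last first.
  rewrite last_row_pair_row; case: eqP => _; last exact: skew_row_sorted.
  exact: last_row_suffix_sorted.
rewrite /= -cats1 reading_word_cat {1}/reading_word /= cats0.
apply: (@ballot_suffix W1); rewrite catA -RE -reading_word_take_row prednK //.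
by rewrite take_oversize // P0_size.
Qed.

Lemma first_rows_last_row_pair : u 0 =1 shape_le (last_row_pair W) 0.
Proof.
move=> r; rewrite last_row_pair_shape shape_le0 // /u /first_rows subn0 /M.
rewrite (count_eq0 (s := W)); last first.
  by apply: sub_all last_row_suffix_gt0 => y; rewrite /= -ltnNge.
case: ltngtP => // gt_r; rewrite skew_inner_out // P0_size.
by rewrite -(prednK n_gt0).
Qed.

End Suffix.

Definition last_row_growth W j :=
  growth u (shape_le (last_row_pair W)) n (M - j).

Let u_chain m : hstrip (u m.+1) (u m) :=
  hstrip_first_rows_sub M m (skew_inner_antitone P0_skew).

Let u_M : u M =1 (fun=> 0).
Proof. by move=> r; rewrite /u subnn. Qed.

Lemma last_row_growth_leq W1 W j j' r : R = W1 ++ W -> j <= j' ->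
  last_row_growth W j r <= last_row_growth W j' r.
Proof.
move=> RE le_j; apply: (growth_leq u_chain (hstrip_last_row_pair RE)).
  exact: first_rows_last_row_pair RE.
exact: leq_sub2l.
Qed.

Lemma last_row_growth_antitone W1 W j : R = W1 ++ W ->
  antitone (last_row_growth W j).
Proof.
move=> RE; have W_chain := hstrip_last_row_pair RE.
have ut := first_rows_last_row_pair RE.
exact: hstrip_antitone (hstrip_growthU u_chain W_chain ut n (M - j)).
Qed.

Let R_sorted : sorted leq R := skew_row_sorted P0_skew n.-1.

Let R_bounds : all (fun y => 0 < y <= n) R.
Proof.
have := ballot_row_leq P0_ballot (skew_row_sorted P0_skew)
  (hstrip_shape_le P0_skew) n.-1.
have := skew_row_gt0 P0_skew n.-1; rewrite prednK // -/R => R_gt0 R_le.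
apply/allP => y y_in; apply/andP.
by split; [apply: (allP R_gt0)|apply: (allP R_le)].
Qed.

Section NextLetter.

Variables (W1 W : seq nat) (x : nat).
Hypothesis RE : R = W1 ++ x :: W.

Let RE' : R = rcons W1 x ++ W.
Proof. by rewrite RE cat_rcons. Qed.

Lemma next_letter_bounds : 0 < x <= n.
Proof. by apply: (allP R_bounds); rewrite RE mem_cat mem_head orbT. Qed.

Lemma next_letter_leq : all (leq x) W.
Proof.
apply: (order_path_min leq_trans); move: R_sorted; rewrite RE.
by rewrite sorted_cat_cons => /andP[].
Qed.

Let s := bump_path (last_row_growth W) x.-1.

Lemma last_row_growth_cons : s M = n.-1 /\
  forall j r, j <= M ->
    last_row_growth (x :: W) j r = last_row_growth W j r + (r == s j).
Proof.
have /andP[x_gt0 x_le] := next_letter_bounds.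
apply: (@growth_add_cell_path u _ _ n x) => //.
- exact: first_rows_last_row_pair RE'.
- exact: hstrip_last_row_pair RE'.
- exact: hstrip_last_row_pair RE.
- move=> i r; rewrite !last_row_pair_shape; case: eqP => _ /=; lia.
- move=> i r le_r; rewrite last_row_pair_shape gtn_eqF; last by rewrite prednK.
  by rewrite shape_le_out // P0_size.
- rewrite last_row_pair_shape eqxx count_eq0 //.
  by apply: sub_all next_letter_leq => y /=; rewrite -ltnNge prednK.
- exact: ballot_last_row_pair RE'.
- exact: ballot_last_row_pair RE.
Qed.

End NextLetter.

Definition last_path (W : seq nat) : nat -> nat :=
  if W is x :: W' then bump_path (last_row_growth W') x.-1 else fun=> n.-1.

Lemma next_path_below W1 x W j : R = W1 ++ x :: W -> j <= M ->
  bump_path (last_row_growth W) x.-1 j <= last_path W j.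
Proof.
move=> RE le_j; have [sM _] := last_row_growth_cons RE.
case: W RE sM => [|y W] RE sM; first by rewrite /= -sM bump_path_leq.
have RE' : R = rcons W1 x ++ y :: W by rewrite RE cat_rcons.
have [_ gE] := last_row_growth_cons RE'; apply: (bump_path_below gE) => //.
by have := next_letter_leq RE => /andP[+ _]; clear; lia.
Qed.

Definition routes_to_last_row (W : seq nat) (routes : seq (seq (nat * nat))) :=
  [/\ size routes = size W, pairwise disjoint_routes routes
    & forall route, route \in routes -> (last (0, 0) route).1 = n.-1].

Lemma phi_word_last_row P W1 W : R = W1 ++ W -> size P.2 = n.-1 ->
    has_shapes M (last_row_growth [::]) P ->
  exists P', [/\ phi_word W P = Some P',
      size P'.2 = (if W is [::] then n.-1 else n),
      has_shapes M (last_row_growth W) P',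
      routes_to_last_row W (phi_word_routes W P)
    & forall route, route \in phi_word_routes W P ->
      left_of_path M (last_row_growth W) (last_path W) route].
Proof.
move=> + P_size P_shapes; elim: W W1 => [|x W IH] W1 RE; first by exists P.
have RE' : R = rcons W1 x ++ W by rewrite RE cat_rcons.
have [PW [W_P PW_size PW_shapes [size_W disjoint_W last_W] left_W]] := IH _ RE'.
have [sM gE] := last_row_growth_cons RE.
have /andP[x_gt0 _] := next_letter_bounds RE.
have [||P' [route [x_PW P'_size P'_shapes last_route on_path]]] :=
    phi_route_path x_gt0 n_gt0 PW_shapes _ sM gE.
- by rewrite PW_size; case: (W) => [|_ _]; rewrite ?leqnn ?leq_pred.
- exact: last_row_growth_antitone RE.
have routesE : phi_word_routes (x :: W) P = route :: phi_word_routes W P.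
  by rewrite /= W_P /= x_PW.
have below := next_path_below RE.
exists P'; rewrite routesE; split=> //.
- by rewrite /= W_P /= /phi x_PW.
- split; first by rewrite /= size_W.
    rewrite pairwise_cons disjoint_W andbT.
    apply/allP => route' /left_W left_route'.
    exact: (disjoint_path_left left_route' (fun j => @below j) on_path).
  by move=> route'; rewrite inE => /predU1P[->|/last_W].
move=> route'; rewrite inE => /predU1P[->|/left_W left_route'].
  apply: (left_of_own_path gE) => // j j' r; exact: last_row_growth_leq RE.
exact: (left_of_next_path gE left_route' (fun j => @below j)).
Qed.

Let full_u m := first_rows P0.1 (n - m).

Let full_u_chain m : hstrip (full_u m.+1) (full_u m) :=
  hstrip_first_rows_sub n m (skew_inner_antitone P0_skew).

Let full_ut : full_u 0 =1 shape_le P0 0.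
Proof.
move=> r; rewrite shape_le0 // /full_u /first_rows subn0; case: ltnP => // ge_r.
by rewrite (skew_inner_out P0_skew) // P0_size.
Qed.

(* The letters n of U slide to the end of the last row. *)
Lemma growth_first_column i :
  growth full_u (shape_le P0) i 1 =1 shape_le (last_row_pair R) i.
Proof.
have P0_chain := hstrip_shape_le P0_skew.
elim: i => [|i IH] r.
  rewrite -(first_rows_last_row_pair (erefl : R = [::] ++ R)) /= /u /full_u.
  by rewrite subn0 subn1.
have f_g := hstrip_growthU full_u_chain P0_chain full_ut i 0.
have g_h := hstrip_growthV full_u_chain P0_chain full_ut i 0.
have := toggleE f_g g_h r; rewrite -growthSS.
have -> : free_end (growth full_u (shape_le P0) i 1)
    (growth full_u (shape_le P0) i.+1 0) r = shape_le P0 i.+1 r.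
  rewrite /free_end !(growth0 full_ut); case: r => // r.
  rewrite IH last_row_pair_shape.
  apply/minn_idPl; case: eqP => [->|_]; last by case: (P0_chain i r).
  by rewrite shape_le_out // P0_size prednK.
rewrite /free_start !(growth0 full_ut) IH !last_row_pair_shape.
have [sub strip] := P0_chain i r.
case: eqP => [rE|_]; last by move: sub strip; lia.
rewrite (@shape_le_out _ P0_skew _ r.+1); last by rewrite P0_size rE prednK.
by rewrite /shape_le rE -/R; lia.
Qed.

Lemma last_row_growth_full j r : j <= n ->
  growth full_u (shape_le P0) n (n - j) r =
  last_row_growth R (minn j n.-1) r + inner P0 n.-1 * ((j == n) && (r == n.-1)).
Proof.
rewrite leq_eqVlt => /predU1P[->|lt_j].
  rewrite subnn (growth0 full_ut) /last_row_growth.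
  rewrite (minn_idPr (leq_pred n)) subnn eqxx.
  rewrite (growth0 (first_rows_last_row_pair (erefl : R = [::] ++ R))).
  rewrite last_row_pair_shape; case: eqP => [->|_]; last by rewrite muln0 addn0.
  by rewrite muln1 addnC.
rewrite (ltn_eqF lt_j) muln0 addn0 (minn_idPl _); last by rewrite -ltnS prednK.
have -> : n - j = (n.-1 - j).+1 by lia.
rewrite growth_shift.
apply: eq_growth => [m k|i]; last exact: growth_first_column.
by rewrite /u /full_u /M; congr (first_rows _ _ k); lia.
Qed.

Lemma restrict_growth j r :
  growth (fun m => first_rows (restrict M P0).1 (M - m))
    (shape_le (restrict M P0)) n (M - j) r =
  last_row_growth [::] j r.
Proof.
apply: eq_growth => [m k|i k].
  rewrite /u /first_rows /=; case: ltnP => // lt_k.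
  by rewrite nth_take // (leq_trans lt_k) ?leq_subr.
rewrite /shape_le /= nth_rcons; case: ltnP => // ge_k.
by rewrite if_same (nth_default [::] ge_k).
Qed.

Let V := [seq y <- R | 0 < y < n].
Let nu := count_mem n (flatten P0.2).
Let mu_n := inner P0 n.-1.

Lemma last_row_split : R = V ++ nseq nu n.
Proof.
rewrite {1}(sorted_split_max R_sorted R_bounds) /nu; congr (_ ++ nseq _ n).
rewrite -[in RHS](cat_take_drop n.-1 P0.2) flatten_cat count_cat.
have P0_chain := hstrip_shape_le P0_skew.
have P0_sorted := skew_row_sorted P0_skew.
rewrite (count_mem_flatten_take P0_ballot P0_sorted P0_chain) ?prednK //.
rewrite (drop_nth [::]) ?P0_size ?prednK // drop_oversize ?P0_size //.
by rewrite /= cats0.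
Qed.

Lemma rho1_restrict : exists P,
  [/\ rho1 (restrict n.-1 P0) P, size P.2 = n.-1
    & has_shapes M (last_row_growth [::]) P].
Proof.
have size_restrict : size (restrict M P0).2 = n.-1.
  by rewrite size_takel // P0_size leq_pred.
have [||P [rho1_P P_size [P_part P_inner P_rows P_shape]]] :=
  @rho1_growth _ n M (skew_pair_restrict M P0_skew) (ballot_take M P0_ballot).
- by rewrite size_restrict leq_pred.
- by rewrite size_take_min geq_minl.
exists P; split=> //; first by rewrite P_size.
split=> // [r|j r le_j]; first by rewrite P_inner restrict_growth.
by rewrite P_shape // restrict_growth.
Qed.

Lemma rho1_iter_chi PR :
  has_shapes M (last_row_growth R) PR ->
  size PR.2 = (if R is [::] then n.-1 else n) ->
  rho1 P0 (iter mu_n (chi n) PR).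
Proof.
move=> PR_shapes PR_size.
have size_mu : size P0.1 <= n by rewrite -P0_size; case: P0_skew.
have le_size : size P0.2 <= n by rewrite P0_size.
have [Q [rho1_Q Q_size Q_shapes]] :=
  rho1_growth P0_skew P0_ballot le_size size_mu.
have PR_shapes' := has_shapes_widen (leq_pred n) PR_shapes.
have chi_shapes := has_shapes_iter_chi mu_n n_gt0 PR_shapes'.
suff -> : iter mu_n (chi n) PR = Q by [].
apply: has_shapes_inj chi_shapes Q_shapes _ _ => [|j r le_j]; last first.
  by rewrite last_row_growth_full.
rewrite Q_size P0_size size_iter_chi PR_size prednK //.
have : 0 < outer_shape P0 n.-1 by rewrite outer_shape_gt0 // P0_size prednK.
rewrite /outer_shape -/R -/mu_n.
case: R => [|y R'] /=; last by rewrite maxnn if_same.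
by rewrite addn0 => ->; apply/maxn_idPl/leq_pred.
Qed.

Lemma rho1_last_row : exists P P' Q,
  [/\ rho1 (restrict n.-1 P0) P, rho1 P0 Q,
      iter nu (obind (phi n)) (Some P) = Some P',
      omap (iter mu_n (chi n)) (phi_word V P') = Some Q
    & routes_to_last_row V (phi_word_routes V P')].
Proof.
have [P [rho1_P P_size P_shapes]] := rho1_restrict.
have insert := phi_word_last_row _ P_size P_shapes.
have [P' [nu_P P'_size P'_shapes [size_nu _ _] _]] := insert _ _ last_row_split.
have [PR [R_P PR_size PR_shapes [size_R disjoint_R last_R] _]] :=
  insert [::] R erefl.
have V_P' : phi_word V P' = Some PR.
  by move: R_P; rewrite {1}last_row_split phi_word_cat nu_P.
have routesE := phi_word_routes_cat V nu_P; rewrite -last_row_split in routesE.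
exists P, P', (iter mu_n (chi n) PR); split=> //.
- exact: rho1_iter_chi.
- by rewrite -phi_word_nseq.
- by rewrite V_P'.
split.
- apply/(@addIn nu); rewrite -[in LHS](size_nseq nu n) -size_nu -size_cat.
  by rewrite -routesE size_R last_row_split size_cat size_nseq.
- by move: disjoint_R; rewrite routesE pairwise_cat => /and3P[].
- by move=> route route_in; apply: last_R; rewrite routesE mem_cat route_in.
Qed.

End LastRow.

Lemma rho1_empty_last_row n P0 : LR n P0 -> size P0.2 < n ->
  exists2 Q, rho1 P0 Q &
  [/\ restrict n.-1 P0 = P0, row P0 n.-1 = [::], inner P0 n.-1 = 0
    & count_mem n (flatten P0.2) = 0].
Proof.
move=> [P0_skew size_le P0_ballot] lt_size.
have le_size : size P0.2 <= n.-1 by lia.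
have [Q [rho1_Q _ _]] :=
  rho1_growth P0_skew P0_ballot size_le (leqnn (size P0.1)).
have le_inner : size P0.1 <= size P0.2 by case: P0_skew.
exists Q => //; split.
- by rewrite /restrict !take_oversize ?(leq_trans le_inner) //; case: (P0).
- by rewrite nth_default.
- exact: skew_inner_out.
rewrite -(take_size P0.2); apply: count_mem_flatten_take => //.
- exact: skew_row_sorted.
- exact: hstrip_shape_le.
Qed.

Theorem mainTheorem3 (n : nat) (mu : seq nat) (T : seq (seq nat))
    (n_gt0 : 1 <= n) (LR_T : LR n (mu, T)) :
  let V := [seq x <- nth [::] T n.-1 | 0 < x < n] in
  let nu_n := count_mem n (flatten T) in
  let mu_n := nth 0 mu n.-1 in
  exists P P' Q : ypair,
    [/\ rho1 (restrict n.-1 (mu, T)) P,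
        rho1 (mu, T) Q,
        iter nu_n (obind (phi n)) (Some P) = Some P',
        omap (iter mu_n (chi n)) (phi_word V P') = Some Q
      & let routes := phi_word_routes V P' in
        [/\ size routes = size V,
            pairwise disjoint_routes routes
          & forall rt, rt \in routes -> (last (0, 0) rt).1 = n.-1]].
Proof.
move=> V nu_n mu_n; have [T_skew size_T T_ballot] := LR_T.
have [eq_size|ne_size] := eqVneq (size T) n.
  exact: (@rho1_last_row n (mu, T)).
have lt_size : size T < n by rewrite ltn_neqAle ne_size.
have [Q rho1_Q [restrictE V_nil mu_n0 nu_n0]] :=
  rho1_empty_last_row LR_T lt_size.
exists Q, Q, Q; rewrite restrictE /V /nu_n /mu_n.
by rewrite [nth [::] T _]V_nil [nth 0 mu _]mu_n0 [count_mem n _]nu_n0.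
Qed.
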